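(* Let $(M,F)$ be a Finsler manifold, $g$ the associated Finsler metric, $R$ the h-curvature of the Cartan connection and $\widehat{R}(\overline{X},\overline{Y})=R(\overline{X},\overline{Y})\overline{\eta}$ the contracted curvature. Suppose that one of the following conditions holds: (a) $\widehat{R}=0$ (the integrability condition for the horizontal distribution); (b) $\widehat{R}(\overline{X},\overline{Y})=\lambda F\big(\ell(\overline{X})\overline{Y}-\ell(\overline{Y})\overline{X}\big)$ for all $\pi$-vector fields $\overline{X},\overline{Y}$, where $\lambda(x,y)$ is a function homogeneous of degree $0$ in $y$ and $\ell(\overline{X}):=F^{-1}g(\overline{X},\overline{\eta})$ (the isotropy condition). Then the two distributions $\mathcal{N}_R$ and $\mathrm{Ker}_R$ coincide; that is, for every $z\in\mathcal{D}$ (where $\mathcal{D}$ is the domain of $F$), with $x=\pi(z)$, $\mathcal{N}_R(x)=\mathrm{Ker}_R(x)$ as subspaces of $T_xM$, both computed at $z$.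
   Context: **Finsler manifold.** $M$ is a smooth manifold and $\pi$ denotes the projection of the bundle of nonzero tangent vectors of $M$ onto $M$. A Finsler function $F$ is a smooth positive function on a nonempty open set $\mathcal{D}$ of nonzero tangent vectors that is conic (invariant under $y\mapsto ty$, $t>0$). $F$ is positively homogeneous of degree 1 in $y$, and the Finsler metric $g_{ij}=\frac12\frac{\partial^2F^2}{\partial y^i\partial y^j}$ is nondegenerate on $\mathcal{D}$. The classical case is that $\mathcal{D}$ consists of all nonzero tangent vectors and $g$ is positive definite. All objects below live over $\mathcal{D}$. **Pullback bundle.** $\pi^{-1}(TM)\to\mathcal{D}$ is the pullback of $TM$ along $\pi$, with fiber $\{z\}\times T_{\pi z}M\simeq T_{\pi z}M$ at $z$. Sections of it are called $\pi$-vector fields and are denoted by barred letters. The Finsler metric $g$ is a metric on this bundle. For a vector (field) $X$ on $\mathcal{D}$, put $\overline{X}=\pi_*X$, where $\pi_*$ is the tangent map of $\pi$, regarded as taking values in $\pi^{-1}(TM)$. The fundamental $\pi$-vector field is $\overline{\eta}(z)=(z,z)$. **Regular connections.** Let $D$ be a linear connection on $\pi^{-1}(TM)$ and let $K(X)=D_X\overline{\eta}$. Put $V_z=\ker(\pi_* )_z$ (vertical space) and $H_z=\{X\in T_z\mathcal{D}: K(X)=0\}$ (horizontal space). $D$ is regular if $T_z\mathcal{D}=V_z\oplus H_z$ for all $z\in\mathcal{D}$. Then $\pi_*:H_z\to T_{\pi z}M$ and $K:V_z\to T_{\pi z}M$ are isomorphisms. **Torsion and curvature.** The classical torsion and curvature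 are $\mathbf{T}(X,Y)=D_X\overline{Y}-D_Y\overline{X}-\pi_*[X,Y]$ and $\mathbf{K}(X,Y)\overline{Z}=D_XD_Y\overline{Z}-D_YD_X\overline{Z}-D_{[X,Y]}\overline{Z}$. The (h)hv-torsion is $T(\overline{X},\overline{Y})=\mathbf{T}(X',Y')$, where $X'$ is the vertical vector with $K(X')=\overline{X}$ and $Y'$ is the horizontal vector with $\pi_*Y'=\overline{Y}$. The h-curvature is $R(\overline{X},\overline{Y})\overline{Z}=\mathbf{K}(X'',Y'')\overline{Z}$, where $X'',Y''$ are the horizontal vectors with $\pi_*X''=\overline{X}$, $\pi_*Y''=\overline{Y}$. **Cartan connection.** The Cartan connection $\nabla$ of $(M,F)$ is the unique regular connection on $\pi^{-1}(TM)$ that is metrical ($\nabla g=0$), satisfies $\mathbf{T}(X,Y)=0$ for all horizontal $X,Y$, and satisfies $g(T(\overline{X},\overline{Y}),\overline{Z})=g(T(\overline{X},\overline{Z}),\overline{Y})$. $R$ denotes its h-curvature. **Nullity and kernel.** For $z\in\mathcal{D}$ and $x=\pi z$: - $\mathcal{N}_R(z)=\{X\in H_z: R(\overline{X},\overline{Y})=0\ \text{ for all } Y\in H_z\}$, and the nullity space is $\mathcal{N}_R(x)=\pi_*(\mathcal{N}_R(z))\subset T_xM$. - The kernel space is $\mathrm{Ker}_R(x)=\{\overline{X}\in\{z\}\times T_xM\simeq T_xM: R(\overline{Y},\overline{Z})\overline{X}=0\ \text{ for all } Y,Z\in H_z\}$. Both spaces depend on the chosen $z$ over $x$. *)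

(* Defs.v *)
From HB Require Import structures.
From mathcomp Require Export all_boot all_order all_algebra.
From mathcomp Require Export all_classical all_reals all_analysis.
Export numFieldNormedType.Exports.
Export Order.TTheory GRing.Theory Num.Theory.

Set Implicit Arguments.
Unset Strict Implicit.
Unset Printing Implicit Defensive.

Local Open Scope classical_set_scope.
Local Open Scope ring_scope.

(* * Smooth maps between open subsets of normed spaces *)

Section Smooth.
Variables (R : realType) (E W : normedModType R).

(* For finite-dimensional [E] and open [U] this is the usual class C^k: [f] is
   differentiable and all its directional derivatives are of class C^(k-1). *)
Fixpoint Ck_on (k : nat) (U : set E) (f : E -> W) : Prop :=
  if k is k'.+1 then
    (forall x, U x -> differentiable f x) /\
    (forall v : E, Ck_on k' U (fun x => 'D_v f x))
  else forall x, U x -> {for x, continuous f}.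

Definition smooth_on (U : set E) (f : E -> W) : Prop :=
  forall k, Ck_on k U f.

End Smooth.

(* * Atlases, tangent vectors, vector fields *)

(* Raw data only: [pt i] is the inverse of the chart [crd i] on the image of
   [dom i] (see [smooth_manifold]), with arbitrary values elsewhere.
   [chart_at x] is a preferred chart around [x]; nothing below depends on which
   chart around [x] it is. *)
Record atlas (R : realType) (E : normedModType R) (X : Type) := Atlas {
  idx : Type;
  dom : idx -> set X;
  crd : idx -> X -> E;
  pt : idx -> E -> X;
  chart_at : X -> idx }.

Section Charts.
Variables (R : realType) (E : normedModType R) (X : Type) (A : atlas E X).

(* A tangent vector is the family of its components in all the charts around
   its base point (set to 0 in the other charts, so that equality of tangent
   vectors is equality of families). *)
Definition tvec : Type := idx A -> E.

Definition chart_img (i : idx A) (U : set X) : set E := crd i @` (U `&` dom i).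

Definition transition (i j : idx A) : E -> E := fun e => crd j (pt i e).

Definition tangent (x : X) (v : tvec) : Prop :=
  (forall i j, dom i x -> dom j x ->
     v j = 'd (transition i j) (crd i x) (v i)) /\
  (forall i, ~ dom i x -> v i = 0).

(* The derivative of a function along a tangent vector at [x]. *)
Definition dderiv (x : X) (v : tvec) (f : X -> R) : R :=
  let i := chart_at A x in
  'D_(v i) (fun e => f (pt i e) : R^o) (crd i x).

Definition smooth_fun (U : set X) (f : X -> R) : Prop :=
  forall i, smooth_on (chart_img i U) (fun e => f (pt i e) : R^o).

Definition smooth_vfield (U : set X) (V : X -> tvec) : Prop :=
  (forall x, U x -> tangent x (V x)) /\
  (forall i, smooth_on (chart_img i U) (fun e => V (pt i e) i)).

Definition bracket (V W : X -> tvec) : X -> tvec := fun x i =>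
  if `[< dom i x >] then
    'D_(V x i) (fun e => W (pt i e) i) (crd i x)
    - 'D_(W x i) (fun e => V (pt i e) i) (crd i x)
  else 0.

(* The vector field around [x] with constant components in [chart_at x] and
   with value [v] at [x]: used to evaluate tensors on tangent vectors. *)
Definition const_ext (x : X) (v : tvec) : X -> tvec := fun x' j =>
  let i := chart_at A x in
  if `[< dom i x' /\ dom j x' >] then 'd (transition i j) (crd i x') (v i)
  else 0.

End Charts.

(* The dimension is [n.+1]: on a 0-dimensional manifold there is no nonzero
   tangent vector, hence no Finsler function. *)
Record smooth_manifold (R : realType) (n : nat) (M : topologicalType)
    (A : atlas 'rV[R]_n.+1 M) : Prop := SmoothManifold {
  mfd_hausdorff : hausdorff_space M;
  mfd_second_countable : @second_countable M;
  mfd_cover : forall x, dom (chart_at A x) x;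
  mfd_dom_open : forall i, open (@dom _ _ _ A i);
  mfd_img_open : forall i, open (@crd _ _ _ A i @` dom i);
  mfd_crdK : forall i x, @dom _ _ _ A i x -> pt i (crd i x) = x;
  mfd_crd_cont : forall i x, @dom _ _ _ A i x -> {for x, continuous (crd i)};
  mfd_pt_cont : forall i x, @dom _ _ _ A i x ->
    {for crd i x, continuous (pt i)};
  mfd_smooth : forall i j, smooth_on (chart_img i (dom j)) (@transition _ _ _ A i j)
}.

(* * The tangent bundle *)

Section TangentBundle.
Variables (R : realType) (n : nat) (M : topologicalType).
Variable A : atlas 'rV[R]_n.+1 M.

Local Notation E := 'rV[R]_n.+1.

(* The tangent bundle is the set of the [z : tpoint] with [TM z]. *)
Definition tpoint : Type := (M * tvec A)%type.
Definition TM : set tpoint := [set z | tangent z.1 z.2].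

(* The induced charts of the tangent bundle: (x, y) is sent to
   (crd i x, component of y in the chart i). *)
Definition tatlas : atlas (E * E)%type tpoint :=
  @Atlas R (E * E)%type tpoint (idx A)
    (fun i => [set z : tpoint | dom i z.1])
    (fun i z => (crd i z.1, z.2 i))
    (fun i e => (pt i e.1, fun j =>
       if `[< dom j (pt i e.1) >] then 'd (transition i j) (e.1) (e.2) else 0))
    (fun z => chart_at A z.1).

Definition openTM (U : set tpoint) : Prop :=
  U `<=` TM /\ forall i : idx tatlas, open (chart_img i U).

(* The tangent map of the projection of the tangent bundle, which reads
   (a, b) |-> a in the induced charts. *)
Definition pi_star (X : tvec tatlas) : tvec A := fun i => (X i).1.

(* pi-vector fields, as sections of the pullback of the tangent bundle; over
   the chart i the pullback bundle is trivialized by the component of index i. *)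
Definition smooth_section (U : set tpoint) (s : tpoint -> tvec A) : Prop :=
  (forall z, U z -> tangent z.1 (s z)) /\
  (forall i : idx tatlas,
     smooth_on (chart_img i U) (fun e => s (pt i e) i)).

Definition eta : tpoint -> tvec A := fun z => z.2.

Definition sec_ext (z : tpoint) (w : tvec A) : tpoint -> tvec A :=
  fun z' => const_ext z.1 w z'.1.

(* * Finsler functions *)

(* g_z(u, v) = 1/2 u^j v^k d^2(F^2)/dy^j dy^k *)
Definition fmetric (F : tpoint -> R) (z : tpoint) (u v : tvec A) : R :=
  let i : idx tatlas := chart_at tatlas z in
  2^-1 * 'D_((0, u i) : (E * E)%type)
           (fun e => 'D_((0, v i) : (E * E)%type)
                       (fun e' => F (pt i e') ^+ 2 : R^o) e)
           (crd i z).

Record finsler (D : set tpoint) (F : tpoint -> R) : Prop := Finsler {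
  fin_nonempty : D !=set0;
  fin_open : openTM D;
  fin_nonzero : forall z, D z -> z.2 <> 0;
  fin_conic : forall x y (t : R), 0 < t -> D (x, y) -> D (x, t *: y);
  fin_smooth : @smooth_fun _ _ _ tatlas D F;
  fin_pos : forall z, D z -> 0 < F z;
  fin_homog : forall x y (t : R), 0 < t -> D (x, y) ->
    F (x, t *: y) = t * F (x, y);
  fin_nondeg : forall z, D z -> forall u, tangent z.1 u ->
    (forall v, tangent z.1 v -> fmetric F z u v = 0) -> u = 0 }.

(* * Linear connections on the pullback bundle over D *)

(* [nabla z X s] is the covariant derivative at [z], in the direction of the
   tangent vector [X] at [z], of a smooth section [s] defined around [z]. *)
Definition connection : Type :=
  forall (z : tpoint) (X : tvec tatlas) (s : tpoint -> tvec A), tvec A.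

Definition around (D : set tpoint) (z : tpoint) (P : set tpoint -> Prop) :=
  exists U, [/\ openTM U, U `<=` D, U z & P U].

Record linear_connection (D : set tpoint) (nabla : connection) : Prop :=
  LinearConnection {
  conn_linear : forall z s, D z -> around D z (smooth_section ^~ s) ->
    forall (c : R) X Y, tangent z X -> tangent z Y ->
    nabla z (c *: X + Y) s = c *: nabla z X s + nabla z Y s;
  conn_add : forall z s1 s2 X, D z -> around D z (smooth_section ^~ s1) ->
    around D z (smooth_section ^~ s2) -> tangent z X ->
    nabla z X (fun z' => s1 z' + s2 z') = nabla z X s1 + nabla z X s2;
  conn_leibniz : forall z (f : tpoint -> R) s X, D z ->
    around D z ((@smooth_fun _ _ _ tatlas) ^~ f) ->
    around D z (smooth_section ^~ s) -> tangent z X ->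
    nabla z X (fun z' => f z' *: s z') =
      dderiv z X f *: s z + f z *: nabla z X s;
  conn_local : forall z s1 s2 X, D z -> around D z (smooth_section ^~ s1) ->
    around D z (fun U => forall z', U z' -> s1 z' = s2 z') -> tangent z X ->
    nabla z X s1 = nabla z X s2;
  conn_smooth : forall U X s, openTM U -> U `<=` D ->
    smooth_vfield U X -> smooth_section U s ->
    smooth_section U (fun z => nabla z (X z) s) }.

Section Connection.
Variable nabla : connection.

(* The map K. *)
Definition Kmap (z : tpoint) (X : tvec tatlas) : tvec A := nabla z X eta.

Definition vertical (z : tpoint) : set (tvec tatlas) :=
  [set X | tangent z X /\ pi_star X = 0].

Definition horizontal (z : tpoint) : set (tvec tatlas) :=
  [set X | tangent z X /\ Kmap z X = 0].

Definition regular (D : set tpoint) : Prop := forall z, D z ->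
  (forall X, tangent z X ->
     exists V H, [/\ vertical z V, horizontal z H & X = V + H]) /\
  vertical z `&` horizontal z = [set 0].

(* Inverses of the isomorphisms K : V_z -> T_xM and pi_* : H_z -> T_xM. *)
Definition vlift (z : tpoint) (u : tvec A) : tvec tatlas :=
  xget 0 [set X | vertical z X /\ Kmap z X = u].

Definition hlift (z : tpoint) (u : tvec A) : tvec tatlas :=
  xget 0 [set X | horizontal z X /\ pi_star X = u].

Definition torsion (X Y : tpoint -> tvec tatlas) (z : tpoint) : tvec A :=
  nabla z (X z) (fun z' => pi_star (Y z'))
  - nabla z (Y z) (fun z' => pi_star (X z'))
  - pi_star (bracket X Y z).

Definition curvature (X Y : tpoint -> tvec tatlas) (s : tpoint -> tvec A)
    (z : tpoint) : tvec A :=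
  nabla z (X z) (fun z' => nabla z' (Y z') s)
  - nabla z (Y z) (fun z' => nabla z' (X z') s)
  - nabla z (bracket X Y z) s.

(* The (h)hv-torsion T(u, v) and the h-curvature R(u, v)w at z. Torsion and
   curvature being tensors, the extensions of the vectors do not matter. *)
Definition hv_torsion (z : tpoint) (u v : tvec A) : tvec A :=
  torsion (const_ext z (vlift z u)) (const_ext z (hlift z v)) z.

Definition h_curvature (z : tpoint) (u v w : tvec A) : tvec A :=
  curvature (const_ext z (hlift z u)) (const_ext z (hlift z v)) (sec_ext z w) z.

Definition h_curvature_hat (z : tpoint) (u v : tvec A) : tvec A :=
  h_curvature z u v (eta z).

Definition nullityH (z : tpoint) : set (tvec tatlas) :=
  [set X | horizontal z X /\ forall Y, horizontal z Y ->
     forall w, tangent z.1 w -> h_curvature z (pi_star X) (pi_star Y) w = 0].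

Definition nullity (z : tpoint) : set (tvec A) := pi_star @` nullityH z.

Definition kernelR (z : tpoint) : set (tvec A) :=
  [set w | tangent z.1 w /\ forall Y Z, horizontal z Y -> horizontal z Z ->
     h_curvature z (pi_star Y) (pi_star Z) w = 0].

Record cartan_connection (D : set tpoint) (F : tpoint -> R) : Prop :=
  CartanConnection {
  cartan_linear : linear_connection D nabla;
  cartan_regular : regular D;
  cartan_metrical : forall z s1 s2 X, D z ->
    around D z (smooth_section ^~ s1) -> around D z (smooth_section ^~ s2) ->
    tangent z X ->
    dderiv z X (fun z' => fmetric F z' (s1 z') (s2 z')) =
      fmetric F z (nabla z X s1) (s2 z) + fmetric F z (s1 z) (nabla z X s2);
  cartan_h_torsion : forall U X Y, openTM U -> U `<=` D ->
    smooth_vfield U X -> smooth_vfield U Y ->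
    (forall z, U z -> horizontal z (X z) /\ horizontal z (Y z)) ->
    forall z, U z -> torsion X Y z = 0;
  cartan_hv_torsion : forall z, D z -> forall u v w,
    tangent z.1 u -> tangent z.1 v -> tangent z.1 w ->
    fmetric F z (hv_torsion z u v) w = fmetric F z (hv_torsion z u w) v }.

End Connection.

(* The form l(u) = g(u, eta) / F. *)
Definition ell (F : tpoint -> R) (z : tpoint) (u : tvec A) : R :=
  (F z)^-1 * fmetric F z u (eta z).

Definition homogeneous0 (D : set tpoint) (lam : tpoint -> R) : Prop :=
  forall x y (t : R), 0 < t -> D (x, y) -> lam (x, t *: y) = lam (x, y).

End TangentBundle.

(* Main.v *)
From HB Require Import structures.
From mathcomp Require Import ring lra.
Require Import Defs.

(** In the chart [(x, y)] of the tangent bundle write [Gam] for the connection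
    form, [C b v := Gam (0, b) v] and [hor u] for the horizontal lift of [u].
    Metricity and the symmetry of the (h)hv-torsion make [C] a quarter of the
    third fibre derivative of [F ^ 2], hence symmetric and killed by [y]; so the
    connection map is the canonical identification on vertical vectors.  Then the
    vanishing of the torsion on horizontal fields reads
    [Gam (hor u) v = Gam (hor v) u], which gives the first Bianchi identity
      [sum_cyc R(u, v) w = sum_cyc C (Rhat(u, v)) w].
    Under either condition the right-hand side vanishes, by symmetry of [C] in the
    isotropic case.  With the skew-symmetry of [g (R(u, v) w, t)] in [w, t] (equality
    of mixed derivatives of [g]), [R] has the pair symmetry of a Riemannian curvature
    tensor, which exchanges nullity and kernel since [g] is nondegenerate. *)

Set Implicit Arguments.
Unset Strict Implicit.
Unset Printing Implicit Defensive.

Local Open Scope classical_set_scope.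
Local Open Scope ring_scope.

(** * Maps of class C^k *)

Section Calculus.
Variable R : realType.
Implicit Types E V W : normedModType R.

(** The connection is known only through its axioms on smooth sections; its coefficients are
    extracted by expanding a section in a frame that is constant in a chart.

    Two kinds of extension are in conflict. Curvature and (h)hv-torsion are evaluated on fields
    constant in a chart, whose brackets vanish. The torsion condition, however, concerns horizontal
    fields, which are not constant: the bracket of two horizontal lifts is vertical, with component
    minus [Rhat]. Differentiating the moving lift is what creates the terms [C (Rhat(u, v)) w] in
    the Bianchi identity.

    The (h)hv-torsion takes its vertical argument through the inverse of [K], which is not yet known
    to be the canonical identification. It is therefore evaluated at vectors [K X] with [X]
    vertical. The quarter is the product of the half in the definition of [g] and a half from
    [D_b g = 2 g (C b _, _)].

    The Bianchi identity involves derivatives, so its hypotheses are needed on an open set in one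
    chart, whereas the (h)hv-torsion at each point is expressed in the preferred chart of that
    point; the facts about [C] have to be carried between charts. *)

Definition clin E W (f : E -> W) : Prop := linear f /\ continuous f.

Lemma clin_diff E W (f : E -> W) x : clin f ->
  differentiable f x /\ forall v, 'D_v f x = f v.
Proof.
move=> [lf cf]; pose fM := GRing.isLinear.Build _ _ _ _ f lf.
pose fL : {linear E -> W} := HB.pack f fM.
have df : differentiable f x by exact: (@linear_differentiable _ _ _ fL).
split=> // v; rewrite deriveE//.
by rewrite (@diff_lin _ _ _ fL).
Qed.

Lemma diff_clin E W (f : E -> W) x : differentiable f x -> clin ('d f x).
Proof.
move=> df; split; last exact: diff_continuous.
by move=> a u v; rewrite linearP.
Qed.

(** The difference [g - f] vanishes near [x], so it is differentiable there with zero differential,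
    and [g] is [f] plus this difference. *)
Lemma near_eq_differentiable E W (f g : E -> W) x :
  {near x, f =1 g} -> differentiable f x -> differentiable g x.
Proof.
move=> fg df.
pose h : E -> W := fun y => g y - f y.
suff dh : differentiable h x.
  have -> : g = f + h by apply/funext => y; rewrite /h fctE addrC subrK.
  exact: differentiableD.
have h0 : {near x, h =1 cst 0}.
  by near=> y; rewrite /h -(near fg y)// subrr.
have hx : h x = 0 by exact: (nbhs_singleton h0).
have c0 : continuous (cst 0 : E -> W) by move=> ?; exact: cvg_cst.
have H : \forall y \near 0, h (y + x) = 0.
  have /= := h0; rewrite (near_shift 0) => H.
  by apply: filterS H => z /=; rewrite subr0.
have hE : h \o shift x = cst (h x) + (\0 : E -> W) +o_ 0 id.
  apply/eqaddoP => _/posnumP[e]; apply: filterS H => y hy.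
  by rewrite /= !fctE hx hy /= addr0 subr0 normr0 mulr_ge0.
have d0 : 'd h x = (\0 : E -> W) :> (E -> W).
  exact: (@diff_unique R E W h \0 x c0 hE).
by apply/diff_locallyP; rewrite d0; split.
Unshelve. all: by end_near. Qed.

Lemma open_near_eq E W (U : set E) (f g : E -> W) x : open U -> U x ->
  (forall y, U y -> f y = g y) -> {near x, f =1 g}.
Proof. by move=> oU Ux fg; near=> y; apply: fg; near: y; exact: open_nbhs_nbhs.
Unshelve. all: by end_near. Qed.

Lemma open_eq_derive E W (U : set E) (f g : E -> W) x v : open U -> U x ->
  (forall y, U y -> f y = g y) -> 'D_v f x = 'D_v g x.
Proof. by move=> oU Ux fg; apply: near_eq_derive; exact: open_near_eq fg. Qed.

Lemma open_eq_differentiable E W (U : set E) (f g : E -> W) x : open U -> U x ->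
  (forall y, U y -> f y = g y) -> differentiable f x -> differentiable g x.
Proof.
by move=> oU Ux fg; apply: near_eq_differentiable; exact: open_near_eq fg.
Qed.

(** A directional derivative sees only the line through [x]. This serves for vertical directions:
    along such a line the base point does not move, so whatever depends on it alone may be
    frozen. *)
Lemma line_eq_derive E W (f g : E -> W) x v :
  (\forall h \near (0 : R), f (h *: v + x) = g (h *: v + x)) ->
  'D_v f x = 'D_v g x.
Proof.
move=> fg; rewrite /derive; congr (lim _).
have fgx : f x = g x by have := nbhs_singleton fg; rewrite scale0r add0r.
rewrite eqEsubset; split; apply/near_eq_cvg/cvg_within.
  by apply: filterS fg => h /= ->; rewrite fgx.
by apply: filterS fg => h /= ->; rewrite fgx.
Qed.

Lemma derive_comp E V W (f : V -> W) (g : E -> V) x v :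
  differentiable g x -> differentiable f (g x) ->
  'D_v (f \o g) x = 'D_('D_v g x) f (g x).
Proof.
move=> dg df; have dfg : differentiable (f \o g) x by exact: differentiable_comp.
by rewrite !deriveE// diff_comp.
Qed.

Lemma derive_lin E W (f : E -> W) x a u v : differentiable f x ->
  'D_(a *: u + v) f x = a *: 'D_u f x + 'D_v f x.
Proof. by move=> df; rewrite !deriveE// linearP. Qed.

Lemma differentiable_scale E W (a : E -> R^o) (f : E -> W) x v :
  differentiable a x -> differentiable f x ->
  differentiable (fun y => a y *: f y) x /\
  'D_v (fun y => a y *: f y) x = 'D_v a x *: f x + a x *: 'D_v f x.
Proof.
move=> da df.
have bil : bilinear_for (GRing.Scale.Law.clone _ _ *:%R _)
  (GRing.Scale.Law.clone _ _ *:%R _) (fun (a : R^o) (w : W) => a *: w).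
  split=> [u'|u] b y z /=; first by rewrite scalerDl scalerA.
  by rewrite scalerDr !scalerA mulrC.
pose bM := bilinear_isBilinear.Build R _ _ _ _ _ _ bil.
pose b : {bilinear R^o -> W -> W} := HB.pack (fun (a : R^o) (w : W) => a *: w) bM.
have cb : continuous (fun p : R^o * W => b p.1 p.2).
  move=> p; exact: (@scale_continuous R W p).
have db := @differentiable_bilin R R^o W W b (a x, f x) cb.
have dp := differentiable_pair da df.
have dc : differentiable ((fun p => b p.1 p.2) \o (fun y => (a y, f y))) x.
  exact: differentiable_comp.
split; first exact: dc.
have -> : (fun y => a y *: f y) = (fun p => b p.1 p.2) \o (fun y => (a y, f y)) by [].
rewrite deriveE// (diff_comp dp db) -[LHS]/('d (fun p => b p.1 p.2) (a x, f x) _).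
have -> := congr1 (fun h => h ('d (fun y => (a y, f y)) x v)) (diff_bilin (a x, f x) cb).
by rewrite diff_pair//= addrC !deriveE.
Qed.

Lemma differentiable_bigsum (I : Type) (r : seq I) E W (f : I -> E -> W) x v :
  (forall i, differentiable (f i) x) ->
  differentiable (fun y => \sum_(i <- r) f i y) x /\
  'D_v (fun y => \sum_(i <- r) f i y) x = \sum_(i <- r) 'D_v (f i) x.
Proof.
move=> df; elim: r => [|i r [IH1 IH2]].
  have -> : (fun y => \sum_(i <- [::]) f i y) = cst 0.
    by apply/funext => y; rewrite big_nil.
  by split; [exact: differentiable_cst|rewrite derive_cst big_nil].
have -> : (fun y => \sum_(j <- i :: r) f j y) = f i + (fun y => \sum_(j <- r) f j y).
  by apply/funext => y; rewrite big_cons.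
split; first exact: differentiableD.
by rewrite deriveD ?big_cons ?IH2//; exact: diff_derivable.
Qed.

Lemma Ck_ext k E W (U : set E) (f g : E -> W) : open U ->
  (forall x, U x -> f x = g x) -> Ck_on k U f -> Ck_on k U g.
Proof.
move=> oU; elim: k f g => [|k IH] f g fg /=.
  move=> cf x Ux; have e := open_near_eq oU Ux fg.
  rewrite /prop_for /continuous_at -(fg _ Ux).
  by apply: cvg_trans (cf _ Ux); apply: near_eq_cvg.
move=> [df Cf]; split.
  by move=> x Ux; apply: open_eq_differentiable fg (df _ Ux).
move=> v; apply: IH (Cf v) => x Ux.
exact: open_eq_derive fg.
Qed.

Lemma Ck_sub k E W (U U' : set E) (f : E -> W) : U' `<=` U ->
  Ck_on k U f -> Ck_on k U' f.
Proof.
move=> sU; elim: k f => [|k IH] f /=; first by move=> cf x /sU; exact: cf.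
by move=> [df Cf]; split => [x /sU/df//|v]; exact/IH/Cf.
Qed.

Lemma Ck_pred k E W (U : set E) (f : E -> W) : Ck_on k.+1 U f -> Ck_on k U f.
Proof.
elim: k f => [|k IH] f.
  by move=> [df _] x Ux; exact/differentiable_continuous/df.
by move=> [df Cf]; split => // v; exact/IH/Cf.
Qed.

Lemma Ck_cst k E W (U : set E) (w : W) : Ck_on k U (fun _ : E => w).
Proof.
elim: k w => [|k IH] w /=; first by move=> x _; exact: cvg_cst.
split=> [x _|v]; first exact: differentiable_cst.
have -> : (fun x => 'D_v (fun _ : E => w) x) = fun=> 0.
  by apply/funext => x; rewrite -[LHS]/('D_v (cst w) x) derive_cst.
exact: IH.
Qed.

Lemma Ck_clin k E W (U : set E) (f : E -> W) : clin f -> Ck_on k U f.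
Proof.
move=> lf; case: k => [|k] /=; first by move=> x _; exact: lf.2.
split=> [x _|v]; first by case: (clin_diff x lf).
have -> : (fun x => 'D_v f x) = fun=> f v.
  by apply/funext => x; case: (clin_diff x lf).
exact: Ck_cst.
Qed.

Lemma Ck_add k E W (U : set E) (f g : E -> W) : open U ->
  Ck_on k U f -> Ck_on k U g -> Ck_on k U (fun x => f x + g x).
Proof.
move=> oU; elim: k f g => [|k IH] f g /=.
  by move=> cf cg x Ux; apply: (@cvgD _ _ _ _ _ f g); [exact: cf|exact: cg].
move=> [df Cf] [dg Cg]; split => [x Ux|v].
  by apply: differentiableD; [exact: df|exact: dg].
apply: (Ck_ext oU _ (IH _ _ (Cf v) (Cg v))) => x Ux.
by rewrite -deriveD//; apply: diff_derivable; [exact: df|exact: dg].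
Qed.

Lemma Ck_scale k E W (U : set E) (a : E -> R^o) (f : E -> W) : open U ->
  Ck_on k U a -> Ck_on k U f -> Ck_on k U (fun x => a x *: f x).
Proof.
move=> oU; elim: k a f => [|k IH] a f.
  move=> ca cf x Ux; apply: (@cvgZ R W E (nbhs x) _ a f); [exact: ca|exact: cf].
move=> Ca' Cf'; have [[da Ca] [df Cf]] := (Ca', Cf').
split => [x Ux|v].
  by case: (differentiable_scale 0 (da _ Ux) (df _ Ux)).
apply: (Ck_ext oU (f := fun x => 'D_v a x *: f x + a x *: 'D_v f x)).
  by move=> x Ux; case: (differentiable_scale v (da _ Ux) (df _ Ux)).
by apply: Ck_add => //; apply: IH;
  first [exact: Ca | exact: Cf | exact: Ck_pred Ca' | exact: Ck_pred Cf'].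
Qed.

Lemma Ck_sum k (I : Type) (r : seq I) E W (U : set E) (f : I -> E -> W) :
  open U -> (forall i, Ck_on k U (f i)) ->
  Ck_on k U (fun y => \sum_(i <- r) f i y).
Proof.
move=> oU Cf; elim: r => [|i r IH].
  by apply: Ck_ext (Ck_cst k U 0) => // x _; rewrite big_nil.
apply: Ck_ext (Ck_add oU (Cf i) IH) => // x _; by rewrite big_cons.
Qed.

Lemma Ck_clin_comp k E V W (U : set E) (f : V -> W) (g : E -> V) : open U ->
  clin f -> Ck_on k U g -> Ck_on k U (fun x => f (g x)).
Proof.
move=> oU lf; elim: k g => [|k IH] g /=.
  by move=> cg x Ux; apply: (@continuous_comp _ _ _ g f); [exact: cg|exact: lf.2].
move=> [dg Cg]; split=> [x Ux|v].
  by apply: (@differentiable_comp _ _ _ _ g f); [exact: dg|case: (clin_diff (g x) lf)].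
apply: Ck_ext (IH _ (Cg v)) => // x Ux.
have [d1 d2] := clin_diff (g x) lf.
by rewrite -[RHS]/('D_v (f \o g) x) derive_comp ?d2//; exact: dg.
Qed.

Lemma Ck_pair k E V W (U : set E) (f : E -> V) (g : E -> W) : open U ->
  Ck_on k U f -> Ck_on k U g -> Ck_on k U (fun x => (f x, g x)).
Proof.
move=> oU; elim: k f g => [|k IH] f g /=.
  by move=> cf cg x Ux; apply: cvg_pair; [exact: cf|exact: cg].
move=> [df Cf] [dg Cg]; split=> [x Ux|v].
  by apply: differentiable_pair; [exact: df|exact: dg].
apply: Ck_ext (IH _ _ (Cf v) (Cg v)) => // x Ux.
have [dfx dgx] := (df _ Ux, dg _ Ux).
rewrite [RHS]deriveE; last exact: differentiable_pair.
by rewrite diff_pair//= !deriveE.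
Qed.

(** Finite dimension, in the form that the chain rule needs: [Ck_on] differentiates in fixed
    directions only, while the chain rule produces a direction that varies with the point. A finite
    basis with continuous coordinates turns the latter into finitely many of the former. *)
Definition fbasis E : Prop := exists (I : finType) (b : I -> E) (c : I -> E -> R^o),
  (forall k, clin (c k)) /\ forall x, x = \sum_k c k x *: b k.

Lemma linear_lincomb (I : finType) (V W : lmodType R) (f : V -> W) (a : I -> R) (b : I -> V) :
  linear f -> f (\sum_k a k *: b k) = \sum_k a k *: f (b k).
Proof.
move=> lf; pose fM := GRing.isLinear.Build _ _ _ _ f lf.
pose fL : {linear V -> W} := HB.pack f fM.
rewrite -[LHS]/(fL _) linear_sum; apply: eq_bigr => k _.
by rewrite linearZ.
Qed.

Lemma fbasis_rV n : fbasis 'rV[R]_n.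
Proof.
exists 'I_n, (fun k => delta_mx 0 k), (fun k (x : 'rV[R]_n) => x 0 k); split.
  by move=> k; split=> [a u v|x]; [rewrite !mxE|exact: coord_continuous].
by move=> x; exact: row_sum_delta.
Qed.

Lemma fbasis_real : fbasis R^o.
Proof.
exists unit, (fun=> 1), (fun=> id); split; first by move=> _; split=> // x; exact: cvg_id.
by move=> x; rewrite big_const card_unit /= addr0 -[LHS]mulr1.
Qed.

Lemma clin_fst E W : clin (fst : E * W -> E).
Proof. by split=> // x; exact: cvg_fst. Qed.

Lemma clin_snd E W : clin (snd : E * W -> W).
Proof. by split=> // x; exact: cvg_snd. Qed.

Lemma clin_comp E V W (f : V -> W) (g : E -> V) : clin f -> clin g -> clin (f \o g).
Proof.
move=> [lf cf] [lg cg]; split=> [a u v|x]; first by rewrite /= lg lf.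
by apply: (@continuous_comp _ _ _ g f); [exact: cg|exact: cf].
Qed.

Lemma fbasis_pair E W : fbasis E -> fbasis W -> fbasis (E * W)%type.
Proof.
move=> [I [b [c [lc bc]]]] [J [b' [c' [lc' bc']]]].
exists (I + J)%type, (fun k => match k with inl i => (b i, 0) | inr j => (0, b' j) end).
exists (fun k x => match k with inl i => c i x.1 | inr j => c' j x.2 end); split.
  case=> k; first exact: (clin_comp (lc k) (@clin_fst E W)).
  exact: (clin_comp (lc' k) (@clin_snd E W)).
move=> [x y]; rewrite big_sumType/=.
have -> : \sum_i c i x *: ((b i, 0) : E * W) = (x, 0).
  rewrite [in RHS](bc x) (big_morph (fun x : E => (x, 0 : W)) (id1 := 0) (op1 := +%R))//.
    by apply: eq_bigr => i _; congr pair; rewrite /= scaler0.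
  by move=> u v; congr pair; rewrite /= addr0.
have -> : \sum_i c' i y *: ((0, b' i) : E * W) = (0, y).
  rewrite [in RHS](bc' y) (big_morph (fun x : W => (0 : E, x)) (id1 := 0) (op1 := +%R))//.
    by apply: eq_bigr => i _; congr pair; rewrite /= scaler0.
  by move=> u v; congr pair; rewrite /= addr0.
by congr pair; rewrite /= ?addr0 ?add0r.
Qed.

Lemma derive_basis E W (I : finType) (b : I -> E) (c : I -> E -> R^o) (f : E -> W) x :
  (forall x, x = \sum_k c k x *: b k) -> differentiable f x ->
  forall v, 'D_v f x = \sum_k c k v *: 'D_(b k) f x.
Proof.
move=> bc df v; rewrite deriveE// [in LHS](bc v) linear_sum.
by apply: eq_bigr => k _; rewrite linearZ deriveE.
Qed.

(** The moving direction [h x] is expanded in the basis, which leaves a finite sum of products. The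
    hypothesis is about derivatives of [f] already composed with [g], so that the induction in
    [Ck_comp] can supply it. *)
Lemma Ck_derive_along k E V W (U : set E) (O : set V) (f : V -> W) (g h : E -> V) :
  fbasis V -> open U -> (forall x, U x -> O (g x)) ->
  (forall x, O x -> differentiable f x) ->
  (forall v, Ck_on k U (fun x => 'D_v f (g x))) ->
  Ck_on k U h -> Ck_on k U (fun x => 'D_(h x) f (g x)).
Proof.
move=> [I [b [c [lc bc]]]] oU gO df Cf Ch.
apply: (Ck_ext oU (f := fun x => \sum_k c k (h x) *: 'D_(b k) f (g x))).
  by move=> x Ux; rewrite -derive_basis//; exact/df/gO.
apply: Ck_sum => // i; apply: Ck_scale => //.
exact: Ck_clin_comp.
Qed.

Lemma Ck_comp k E V W (U : set E) (O : set V) (f : V -> W) (g : E -> V) :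
  fbasis V -> open U -> (forall x, U x -> O (g x)) ->
  Ck_on k O f -> Ck_on k U g -> Ck_on k U (fun x => f (g x)).
Proof.
move=> bV oU gO; elim: k f g gO => [|k IH] f g gO.
  by move=> cf cg x Ux; apply: (@continuous_comp _ _ _ g f); [exact: cg|exact/cf/gO].
move=> [df Cf] Cg; have [dg Cdg] := Cg; split=> [x Ux|v].
  by apply: (@differentiable_comp _ _ _ _ g f); [exact: dg|exact/df/gO].
apply: (Ck_ext oU (f := fun x => 'D_('D_v g x) f (g x))).
  by move=> x Ux; rewrite -(derive_comp v (dg _ Ux) (df _ (gO _ Ux))).
apply: (@Ck_derive_along k E V W U O) => //.
by move=> w; exact: (IH (fun y => 'D_w f y) g gO (Cf w) (Ck_pred Cg)).
exact: (Cdg v).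
Qed.

Lemma smooth_comp E V W (U : set E) (O : set V) (f : V -> W) (g : E -> V) :
  fbasis V -> open U -> (forall x, U x -> O (g x)) ->
  smooth_on O f -> smooth_on U g -> smooth_on U (fun x => f (g x)).
Proof. by move=> bV oU gO sf sg k; exact: (Ck_comp bV oU gO). Qed.

(** Components of vector fields and sections change in this way between charts: the differential of
    a transition, at a point and on a vector that both vary. *)
Lemma smooth_derive_along E V W (U : set E) (O : set V) (f : V -> W) (g h : E -> V) :
  fbasis V -> open U -> (forall x, U x -> O (g x)) ->
  smooth_on O f -> smooth_on U g -> smooth_on U h ->
  smooth_on U (fun x => 'd f (g x) (h x)).
Proof.
move=> bV oU gO sf sg sh k.
have df x : O x -> differentiable f x by move=> Ox; exact: (sf 1%N).1.
apply: (Ck_ext oU (f := fun x => 'D_(h x) f (g x))).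
  by move=> x Ux; rewrite deriveE//; exact/df/gO.
apply: (Ck_derive_along bV oU gO) => // v.
exact: (Ck_comp bV oU gO ((sf k.+1).2 v) (sg k)).
Qed.

Lemma smooth_diff E W (U : set E) (f : E -> W) x : smooth_on U f -> U x ->
  differentiable f x.
Proof. by move=> sf Ux; exact: (sf 1%N).1. Qed.

Lemma smooth_derive E W (U : set E) (f : E -> W) v : smooth_on U f ->
  smooth_on U (fun x => 'D_v f x).
Proof. by move=> sf k; exact: (sf k.+1).2. Qed.

Lemma smooth_ext E W (U : set E) (f g : E -> W) : open U ->
  (forall x, U x -> f x = g x) -> smooth_on U f -> smooth_on U g.
Proof. by move=> oU fg sf k; exact: Ck_ext (sf k). Qed.

Lemma smooth_sub E W (U U' : set E) (f : E -> W) : U' `<=` U ->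
  smooth_on U f -> smooth_on U' f.
Proof. by move=> sU sf k; exact: Ck_sub (sf k). Qed.

End Calculus.

(** * Symmetry of second derivatives and a product rule *)

Section Schwarz.
Variable R : realType.
Implicit Types E V W : normedModType R.

Lemma line_differentiable E (a v : E) (s : R) :
  differentiable (fun t : R => t *: v + a) s /\ 'D_1 (fun t : R => t *: v + a) s = v.
Proof.
have d1 : differentiable (fun t : R => t *: v) s by exact: ex_diff.
split.
  have := @differentiableD _ _ _ (fun t : R => t *: v) (cst a) s d1 (differentiable_cst _ _).
  by apply.
have d1' : derivable (fun t : R => t *: v) s 1 by exact: diff_derivable.
have d0 : derivable (cst a : R -> E) s 1 by exact: derivable_cst.
have -> : (fun t : R => t *: v + a) = (fun t : R => t *: v) + cst a by [].
by rewrite deriveD// derive_cst addr0 deriveE// diff_val scale1r.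
Qed.

Lemma line_MVT E (F : E -> R^o) (a v : E) (h : R) : 0 < h ->
  (forall s, 0 <= s <= h -> differentiable F (s *: v + a)) ->
  exists2 s, 0 <= s <= h & F (h *: v + a) - F a = h * 'D_v F (s *: v + a).
Proof.
move=> h0 dF.
pose phi : R -> R := fun s => F (s *: v + a).
have dphi s : 0 <= s <= h -> differentiable phi s.
  move=> sh; apply: (@differentiable_comp _ _ _ _ (fun t : R => t *: v + a) F).
    by case: (line_differentiable a v s).
  exact: dF.
have ephi s : 0 <= s <= h -> is_derive s 1 phi ('D_v F (s *: v + a)).
  move=> sh; apply: DeriveDef; first exact/diff_derivable/dphi.
  have [d1 d2] := line_differentiable a v s.
  have -> : phi = F \o (fun t : R => t *: v + a) by [].
  by rewrite derive_comp ?d2//; exact: dF.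
have [||s] := @MVT R phi (fun s => 'D_v F (s *: v + a)) 0 h h0.
- by move=> s; rewrite in_itv/= => /andP[s0 sh]; apply: ephi; rewrite !ltW.
- apply: continuous_in_subspaceT => s; rewrite inE/= in_itv/= => sh.
  exact/differentiable_continuous/dphi.
rewrite in_itv/= => /andP[s0 sh] e; exists s; first by rewrite !ltW.
by rewrite subr0 /phi scale0r add0r in e; rewrite e mulrC.
Qed.

(** The second difference of [f] is a first difference along [v] of [G p = f (h *: w + p) - f p].
    The mean value theorem is applied to [G] along [v], then to the derivative of [f] in direction
    [v] along [w]. *)
Lemma rectangle_MVT E (U : set E) (f : E -> R^o) (x v w : E) (h : R) :
  0 < h -> Ck_on 2 U f ->
  (forall s t, 0 <= s <= h -> 0 <= t <= h -> U (t *: w + (s *: v + x))) ->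
  exists s t, [/\ 0 <= s <= h, 0 <= t <= h &
    f (h *: w + (h *: v + x)) - f (h *: v + x) - f (h *: w + x) + f x =
    h * (h * 'D_w (fun y => 'D_v f y) (t *: w + (s *: v + x)))].
Proof.
move=> h0 [df Cf] hU.
pose G : E -> R^o := fun p => f (h *: w + p) - f p.
have hh : 0 <= h <= h by rewrite (ltW h0) lexx.
have h00 : (0 : R) <= 0 <= h by rewrite (ltW h0) lexx.
have sh p : differentiable (fun p : E => h *: w + p) p /\
    forall v, 'D_v (fun p : E => h *: w + p) p = v.
  split; first by apply: differentiableD.
  move=> u; have -> : (fun p : E => h *: w + p) = cst (h *: w) + id by [].
  by rewrite deriveD// derive_cst derive_id add0r.
have dG s : 0 <= s <= h -> differentiable G (s *: v + x) /\
   'D_v G (s *: v + x) = 'D_v f (h *: w + (s *: v + x)) - 'D_v f (s *: v + x).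
  move=> hs.
  have d1 : differentiable f (h *: w + (s *: v + x)) by apply/df/hU.
  have d2 : differentiable f (s *: v + x).
    by have := hU _ _ hs h00; rewrite scale0r add0r => /df.
  have [d3 d4] := sh (s *: v + x).
  have d5 : differentiable (f \o (fun p => h *: w + p)) (s *: v + x).
    exact: differentiable_comp.
  have -> : G = (f \o (fun p => h *: w + p)) - f by [].
  split; first exact: differentiableB.
  have d6 := deriveB (diff_derivable d5 : derivable _ _ v) (diff_derivable d2 : derivable _ _ v).
  by rewrite d6 (derive_comp v d3 d1) d4.
have [s hs eG] := line_MVT h0 (fun s hs => (dG s hs).1).
have [dv _] := Cf v.
have [t ht eD] := @line_MVT _ (fun y => 'D_v f y) (s *: v + x) w h h0
  (fun t ht => dv _ (hU s t hs ht)).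
exists s, t; split=> //.
by rewrite -eD -(dG _ hs).2 -eG /G opprB [RHS]addrA [RHS]addrAC.
Qed.

Lemma small_rectangle E (N : set E) (x v w : E) : nbhs x N ->
  exists2 h : R, 0 < h & forall s t, 0 <= s <= h -> 0 <= t <= h ->
    N (t *: w + (s *: v + x)).
Proof.
move=> /nbhs_ballP[r /= r0 rN].
(* The summand 1 keeps the denominator positive even when [v] and [w] are zero, and makes the final
   inequality strict. *)
have c0 : 0 < `|v| + `|w| + 1 by rewrite ltr_pwDr// addr_ge0.
exists (r / (`|v| + `|w| + 1)); first by rewrite divr_gt0.
move=> s t /andP[s0 sh] /andP[t0 th]; apply: rN.
rewrite -ball_normE /ball_/= addrA opprD addrCA subrr addr0 normrN.
apply: (le_lt_trans (ler_normD _ _)); rewrite !normrZ !ger0_norm//.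
have -> : r = r / (`|v| + `|w| + 1) * (`|v| + `|w| + 1) by rewrite divfK ?gt_eqF.
apply: (@le_lt_trans _ _ (r / (`|v| + `|w| + 1) * (`|v| + `|w|))).
  by rewrite [X in _ <= X]mulrDr addrC lerD// ler_wpM2r.
by rewrite ltr_pM2l ?divr_gt0// ltrDl.
Qed.

(** The second difference is symmetric in [v] and [w]. Using [rectangle_MVT] in both orders equates
    a value of one mixed derivative with a value of the other, at two points close to [x];
    continuity of both derivatives at [x] concludes. *)
Lemma schwarz_real E (U : set E) (f : E -> R^o) (x v w : E) :
  open U -> U x -> Ck_on 2 U f ->
  'D_v (fun y => 'D_w f y) x = 'D_w (fun y => 'D_v f y) x.
Proof.
move=> oU Ux Cf; have [_ Cf1] := Cf.
pose A y : R := 'D_w (fun y => 'D_v f y) y; pose B y : R := 'D_v (fun y => 'D_w f y) y.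
have cA : {for x, continuous A} by exact: (Cf1 v).2 w x Ux.
have cB : {for x, continuous B} by exact: (Cf1 w).2 v x Ux.
have key (a b p q e : R) : p = q -> `|a - q| < e / 2 -> `|b - p| < e / 2 -> `|b - a| <= e.
  move=> -> /ltW ha /ltW hb; rewrite (splitr e) -(subrKA q).
  by rewrite (le_trans (ler_normD _ _))// lerD// distrC.
suff : `|B x - A x| <= 0 by rewrite normr_le0 subr_eq0 => /eqP.
apply/ler_addgt0Pr => e e0; rewrite add0r.
have e20 : 0 < e / 2 by rewrite divr_gt0.
have /cvgrPdist_lt/(_ _ e20) nA := cA.
have /cvgrPdist_lt/(_ _ e20) nB := cB.
have nU : nbhs x U by exact: open_nbhs_nbhs.
have [h h0 hN] := small_rectangle v w (filterI nU (filterI nA nB)).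
have [s [t [hs ht]]] := rectangle_MVT h0 Cf (fun s t hs ht => (hN s t hs ht).1).
have hU' s1 t1 : 0 <= s1 <= h -> 0 <= t1 <= h -> U (t1 *: v + (s1 *: w + x)).
  by move=> hs1 ht1; rewrite addrCA; exact: (hN t1 s1 ht1 hs1).1.
have [t' [s' [ht' hs']]] := rectangle_MVT h0 Cf hU'.
rewrite [h *: v + (h *: w + x)]addrCA [s' *: v + _]addrCA => e1 e2.
have e3 : h * (h * B (t' *: w + (s' *: v + x))) = h * (h * A (t *: w + (s *: v + x))).
  by rewrite -[LHS]e1 -[RHS]e2; congr (_ + _); rewrite addrAC.
have h1 : h != 0 by rewrite gt_eqF.
have {}e3 := mulfI h1 (mulfI h1 e3).
have [_ [lA _]] := hN s t hs ht.
have [_ [_ lB]] := hN s' t' hs' ht'.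
exact: (key _ _ _ _ _ e3 lA lB).
Qed.

Lemma schwarz E W (U : set E) (f : E -> W) (x v w : E) : fbasis W ->
  open U -> U x -> smooth_on U f ->
  'D_v (fun y => 'D_w f y) x = 'D_w (fun y => 'D_v f y) x.
Proof.
move=> [I [b [c [lc bc]]]] oU Ux sf.
have inj (y z : W) : (forall k, c k y = c k z) -> y = z.
  by move=> e; rewrite (bc y) (bc z); apply: eq_bigr => k _; rewrite e.
have com k v0 (g : E -> W) y : differentiable g y -> c k ('D_v0 g y) = 'D_v0 (c k \o g) y.
  move=> dg; have [d1 d2] := clin_diff (g y) (lc k).
  by rewrite (derive_comp v0 dg d1) d2.
have com2 k v0 w0 : c k ('D_v0 (fun y => 'D_w0 f y) x) = 'D_v0 (fun y => 'D_w0 (c k \o f) y) x.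
  rewrite com; last exact: smooth_diff (smooth_derive w0 sf) Ux.
  apply: (open_eq_derive _ oU Ux) => y Uy /=.
  by rewrite com//; exact: smooth_diff sf Uy.
apply: inj => k; rewrite !com2; apply: (schwarz_real v w oU Ux).
exact: (Ck_clin_comp oU (lc k) (sf 2%N)).
Qed.

(** Differentiability is assumed of each [B ^~ w] separately, not of [B] as an operator-valued map.
    Expanding [s y] in a finite basis reduces the claim to the product rule for scalar multiples. *)
Lemma derive_apply E V W (U : set E) (B : E -> V -> W) (s : E -> V) (x v : E) :
  fbasis V -> open U -> U x -> (forall y, U y -> linear (B y)) ->
  (forall w, differentiable (B ^~ w) x) -> differentiable s x ->
  differentiable (fun y => B y (s y)) x /\
  'D_v (fun y => B y (s y)) x = 'D_v (B ^~ (s x)) x + B x ('D_v s x).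
Proof.
move=> [I [b [c [lc bc]]]] oU Ux lB dB ds.
have dcs k : differentiable (c k \o s) x.
  by apply: differentiable_comp => //; case: (clin_diff (s x) (lc k)).
have e (s' : E -> V) y : U y -> \sum_k c k (s' y) *: B y (b k) = B y (s' y).
  by move=> Uy; rewrite [in RHS](bc (s' y)) linear_lincomb//; exact: lB.
have dk k u := differentiable_scale u (dcs k) (dB (b k)).
have [d1 d2] := differentiable_bigsum (index_enum I) v (fun k => (dk k v).1).
split; first exact: (open_eq_differentiable oU Ux (e s)).
rewrite -(open_eq_derive v oU Ux (e s)) d2.
(* The same expansion with the argument frozen at [s x] computes the first term of the right-hand
   side. *)
have dz k : differentiable (cst (c k (s x)) : E -> R^o) x by exact: differentiable_cst.
have dk' k u := differentiable_scale u (dz k) (dB (b k)).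
have [_ d3] := differentiable_bigsum (index_enum I) v (fun k => (dk' k v).1).
rewrite -(open_eq_derive v oU Ux (e (cst (s x)))) d3.
rewrite -(e (cst ('D_v s x)) x Ux) -big_split/=; apply: eq_bigr => k _.
rewrite (dk k v).2 (dk' k v).2 derive_cst scale0r add0r addrC; congr (_ + _ *: _).
by have [d4 d5] := clin_diff (s x) (lc k); rewrite derive_comp// d5.
Qed.

End Schwarz.

(** * Bianchi identity and skew-symmetry of the curvature in coordinates *)

Section LocalConnection.
Variables (R : realType) (E : normedModType R) (bE : fbasis E).
Local Notation P := (E * E)%type.
Variables (U : set P) (oU : open U).
Variable Gam : P -> P -> E -> E.
Hypothesis lin1 : forall p, U p -> forall w, linear (fun xi => Gam p xi w).
Hypothesis lin2 : forall p, U p -> forall xi, linear (Gam p xi).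
Hypothesis smooth_Gam : forall xi w, smooth_on U (fun p => Gam p xi w).

(** The curvature on constant fields [xi] and [zeta], which commute, so there is no bracket term.
    Curvature being a tensor, the values at [p] of other fields may be inserted. *)
Definition curv (p xi zeta : P) (w : E) : E :=
  'D_xi (fun q => Gam q zeta w) p - 'D_zeta (fun q => Gam q xi w) p
  + (Gam p xi (Gam p zeta w) - Gam p zeta (Gam p xi w)).

(** The connection map sends [(u, b)] to [b + Gam p (u, b) p.2]. When [Gam p (0, b) p.2] vanishes,
    its zero over [u] is the vector given here. *)
Definition hor (p : P) (u : E) : P := (u, - Gam p (u, 0) p.2).

Lemma linear_add (V W : lmodType R) (f : V -> W) : linear f ->
  forall x y, f (x + y) = f x + f y.
Proof. by move=> lf x y; have := lf 1 x y; rewrite !scale1r. Qed.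

Lemma linear_zero (V W : lmodType R) (f : V -> W) : linear f -> f 0 = 0.
Proof.
move=> lf; have := linear_add lf 0 0.
by rewrite addr0 => /eqP; rewrite -subr_eq0 opprD addrA subrr sub0r oppr_eq0 => /eqP.
Qed.

Lemma linear_opp (V W : lmodType R) (f : V -> W) : linear f ->
  forall x, f (- x) = - f x.
Proof.
by move=> lf x; have := lf (-1) x 0; rewrite !scaleN1r addr0 (linear_zero lf) addr0.
Qed.

Lemma cyclic_sum0 (V : zmodType) (a b c d e f : V) :
  a - b + (d - e) + (b - c + (e - f)) + (c - a + (f - d)) = 0.
Proof. by rewrite (addrACA (a - b)) !subrKA addrACA !subrKA !subrr addr0. Qed.

Section Bianchi.
Hypothesis vert : forall p, U p -> forall b, Gam p (0, b) p.2 = 0.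
Hypothesis tors : forall p, U p -> forall u v,
  Gam p (hor p u) v = Gam p (hor p v) u.

(** [N] contains the coefficients of the nonlinear connection, [H] those of covariant
    differentiation along horizontal lifts. *)
Let N u p := Gam p (u, 0) p.2.
Let H u v p := Gam p (hor p u) v.

Let dN u p : U p -> differentiable (N u) p.
Proof.
move=> Up; have [d _] := clin_diff p (@clin_snd R E E).
have dG w : differentiable (fun q => Gam q (u, 0) w) p by exact: smooth_diff Up.
by have [] := derive_apply 0 bE oU Up (fun q Uq => lin2 Uq (u, 0)) dG d.
Qed.

Let dhor u p xi : U p -> differentiable (hor ^~ u) p /\
  'D_xi (hor ^~ u) p = (0, - 'D_xi (N u) p).
Proof.
move=> Up; have d := dN u Up.
have d1 : differentiable (cst u : P -> E) p by exact: differentiable_cst.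
have d2 : differentiable (- N u) p by exact: differentiableN.
have d3 := differentiable_pair d1 d2.
split; first exact: d3.
rewrite -[LHS]/('D_xi (fun q => (cst u q, (- N u) q)) p) deriveE// diff_pair//=.
by congr pair; rewrite -deriveE// ?derive_cst// deriveN//; exact: diff_derivable.
Qed.

Let HN u p : U p -> H u p.2 p = N u p.
Proof.
move=> Up; rewrite /H /hor.
have -> : (u, - N u p) = (u, 0) + (0, - N u p) :> P.
  by congr pair; rewrite /= ?addr0 ?add0r.
by rewrite (linear_add (lin1 Up p.2)) vert// addr0.
Qed.

(** [curv] freezes the direction at [hor p u], whereas in [H] the lift moves with the point. The two
    derivatives differ by a vertical correction coming from the derivative of [N u]. *)
Let dH u v p zeta : U p -> differentiable (H u v) p /\
  'D_zeta (fun q => Gam q (hor p u) v) p =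
  'D_zeta (H u v) p + Gam p (0, 'D_zeta (N u) p) v.
Proof.
move=> Up; have [d e] := dhor u zeta Up.
have dG xi : differentiable (fun q => Gam q xi v) p by exact: smooth_diff Up.
have [d1 e1] := derive_apply zeta (fbasis_pair bE bE) oU Up
  (fun q Uq => lin1 Uq v) dG d.
split; first exact: d1.
rewrite -[X in _ = X + _]/('D_zeta (fun q => Gam q (hor q u) v) p) e1 e -addrA.
rewrite -(linear_add (lin1 Up v)).
have -> : (0, - 'D_zeta (N u) p) + (0, 'D_zeta (N u) p) = 0 :> P.
  by congr pair; rewrite /= ?addr0// addNr.
by rewrite (linear_zero (lin1 Up v)) addr0.
Qed.

Let HD u p zeta : U p ->
  'D_zeta (N u) p = 'D_zeta (H u p.2) p + H u zeta.2 p.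
Proof.
move=> Up; rewrite -(open_eq_derive zeta oU Up (fun q Uq => HN u Uq)).
have [d e] := clin_diff p (@clin_snd R E E).
have lB q : U q -> linear (fun w => H u w q) by move=> Uq; exact: lin2.
have [_] := derive_apply zeta bE oU Up lB (fun w => (dH u w 0 Up).1) d.
by rewrite e.
Qed.

(** The curvature that [H] would have if horizontal lifts commuted. *)
Let S u v w p := 'D_(hor p u) (H v w) p - 'D_(hor p v) (H u w) p
  + (H u (H v w p) p - H v (H u w p) p).

Let curvE u v w p : U p -> curv p (hor p u) (hor p v) w =
  S u v w p + Gam p (0, 'D_(hor p u) (N v) p - 'D_(hor p v) (N u) p) w.
Proof.
move=> Up; rewrite /curv (dH v w _ Up).2 (dH u w _ Up).2 /S.
set a := 'D_(hor p u) (N v) p; set b := 'D_(hor p v) (N u) p.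
have -> : (0, a - b) = (0, a) - (0, b) :> P by congr pair; rewrite /= subr0.
rewrite (linear_add (lin1 Up w)) (linear_opp (lin1 Up w)) opprD.
by rewrite [X in X + _ = _]addrACA [LHS]addrAC.
Qed.

(** For [w = p.2] the correction in [curvE] vanishes by [vert], and [HD] evaluates [S]. The result
    is minus the vertical component of the bracket of the two horizontal lifts, so the vertical
    direction in the correction of [curvE] is the contracted curvature itself. *)
Let curvhat u v p : U p -> curv p (hor p u) (hor p v) p.2 =
  'D_(hor p u) (N v) p - 'D_(hor p v) (N u) p.
Proof.
move=> Up; rewrite curvE// vert// addr0 /S !HN// !HD//=.
have neg x y : H x (- y) p = - H x y p by exact: (linear_opp (lin2 Up (hor p x))).
rewrite -/(N u p) -/(N v p) !neg.
set a := H u _ p; set b := H v _ p; set c := 'D__ _ _; set d := 'D__ _ _.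
by rewrite opprB [a - d]addrC [RHS]addrACA [- b + a]addrC.
Qed.

(** In the cyclic sum the [S] parts cancel: by the symmetry of [H] in its two vectors, every
    derivative term and every quadratic term meets its opposite. The vertical corrections of [curvE]
    remain. *)
Lemma bianchi u v w p (r := fun a b c => curv p (hor p a) (hor p b) c) : U p ->
  r u v w + r v w u + r w u v =
  Gam p (0, r u v p.2) w + Gam p (0, r v w p.2) u + Gam p (0, r w u p.2) v.
Proof.
move=> Up; rewrite /r !curvhat// !curvE//.
suff e : S u v w p + S v w u p + S w u v p = 0.
  by rewrite (addrACA (S u v w p)) [LHS]addrACA e add0r.
have sH a b q : U q -> H a b q = H b a q by move=> Uq; exact: tors.
have sD xi a b : 'D_xi (H a b) p = 'D_xi (H b a) p.
  exact: (open_eq_derive xi oU Up (sH a b)).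
rewrite /S (sD _ v w) (sD _ u w) (sD _ v u) (sH v w p)// (sH u w p)// (sH v u p)//.
exact: cyclic_sum0.
Qed.

End Bianchi.

Section Metric.
Variable Gm : P -> E -> E -> R^o.
Hypothesis linm1 : forall p, U p -> forall v, linear (fun u => Gm p u v).
Hypothesis linm2 : forall p, U p -> forall u, linear (Gm p u).
Hypothesis smooth_Gm : forall u v, smooth_on U (fun p => Gm p u v).
Hypothesis metr : forall p, U p -> forall xi u v,
  'D_xi (fun q => Gm q u v) p = Gm p (Gam p xi u) v + Gm p u (Gam p xi v).

(** The terms are grouped so that the last bracket is symmetric in [xi] and [zeta]: it drops out
    when the two mixed derivatives are equated, and the rest is the curvature acting on [u] and on
    [v]. *)
Let dd p xi zeta u v : U p ->
  'D_zeta (fun q => 'D_xi (fun q => Gm q u v) q) p =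
  Gm p ('D_zeta (fun q => Gam q xi u) p + Gam p zeta (Gam p xi u)) v +
  Gm p u ('D_zeta (fun q => Gam q xi v) p + Gam p zeta (Gam p xi v)) +
  (Gm p (Gam p xi u) (Gam p zeta v) + Gm p (Gam p zeta u) (Gam p xi v)).
Proof.
move=> Up.
rewrite (open_eq_derive zeta oU Up (fun q Uq => metr Uq xi u v)).
have dG w : differentiable (fun q => Gam q xi w) p by exact: smooth_diff Up.
have dm a b : differentiable (fun q => Gm q a b) p by exact: smooth_diff Up.
have [d1 e1] := derive_apply zeta bE oU Up (fun q Uq => linm1 Uq v)
  (fun w => dm w v) (dG u).
have [d2 e2] := derive_apply zeta bE oU Up (fun q Uq => linm2 Uq u)
  (fun w => dm u w) (dG v).
have -> := @deriveD _ _ _ _ _ p zeta (diff_derivable d1) (diff_derivable d2).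
rewrite e1 e2 !metr// (linear_add (linm1 Up v)) (linear_add (linm2 Up u)).
set a := Gm p _ _; set b := Gm p _ _; set c := Gm p _ _; set d := Gm p _ _.
set e := Gm p _ _; set f := Gm p _ _.
by move: a b c d e f => a b c d e f; ring.
Qed.

Lemma curv_skew p xi zeta u v : U p ->
  Gm p (curv p xi zeta u) v = - Gm p u (curv p xi zeta v).
Proof.
move=> Up.
have := schwarz xi zeta (fbasis_real R) oU Up (smooth_Gm u v).
rewrite !dd// /curv.
have l1 := fun w => (linear_add (linm1 Up w), linear_opp (linm1 Up w)).
have l2 := fun w => (linear_add (linm2 Up w), linear_opp (linm2 Up w)).
rewrite !l1 !l2.
set a1 := Gm p _ _; set a2 := Gm p _ _; set a3 := Gm p _ _; set a4 := Gm p _ _.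
set a5 := Gm p _ _; set a6 := Gm p _ _; set a7 := Gm p _ _; set a8 := Gm p _ _.
set a9 := Gm p _ _; set a10 := Gm p _ _.
move: a1 a2 a3 a4 a5 a6 a7 a8 a9 a10 => a1 a2 a3 a4 a5 a6 a7 a8 a9 a10.
move=> e; lra.
Qed.
End Metric.
End LocalConnection.

(** * Algebra of curvature tensors and of the Cartan tensor *)

Lemma pair_symmetry (R : realType) (T : Type) (r : T -> T -> T -> T -> R) :
  (forall u v w t, r u v w t = - r v u w t) ->
  (forall u v w t, r u v w t = - r u v t w) ->
  (forall u v w t, r u v w t + r v w u t + r w u v t = 0) ->
  forall u v w t, r u v w t = r w t u v.
Proof.
move=> s1 s2 b u v w t.
(* The classical octahedron argument: one cyclic identity for each choice of the last argument. The
   antisymmetries that follow identify their terms up to sign, and the claim is a linear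
   combination. *)
have := (b u v w t, b v w t u, b w t u v, b t u v w).
have := (s1 w u v t, s2 v w t u, s2 w t v u, s1 t v w u, s2 v t w u).
have := (s1 t u w v, s2 u t w v, s2 u w t v, s1 t u v w, s2 u v t w).
by move=> [[[[? ?] ?] ?] ?] [[[[? ?] ?] ?] ?] [[[? ?] ?] ?]; lra.
Qed.

Lemma riemann_pair_symmetry (R : realType) (E : lmodType R)
    (K : E -> E -> E -> E) (g : E -> E -> R^o) :
  (forall u v w, K u v w = - K v u w) ->
  (forall v, linear (g ^~ v)) -> (forall u v, g u v = g v u) ->
  (forall u v w t, g (K u v w) t = - g w (K u v t)) ->
  (forall u v w, K u v w + K v w u + K w u v = 0) ->
  forall u v w t, g (K u v w) t = g (K w t u) v.
Proof.
move=> anti lin sym skew cyc; apply: (@pair_symmetry R E (fun u v w t => g (K u v w) t)).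
- by move=> a b c d; rewrite anti (linear_opp (lin d)).
- by move=> a b c d; rewrite skew sym.
- by move=> a b c d; rewrite -!(linear_add (lin d)) cyc (linear_zero (lin d)).
Qed.

(** Each summand becomes [k *: (l a *: C b c - l b *: C a c)]. By symmetry of [C], every product of
    this kind occurs twice in the cyclic sum, with opposite signs. *)
Lemma isotropic_cyclic (R : realType) (E : lmodType R) (C K : E -> E -> E)
    (k : R) (l : E -> R) :
  (forall w, linear (C ^~ w)) -> (forall u v, C u v = C v u) ->
  (forall u v, K u v = k *: (l u *: v - l v *: u)) ->
  forall u v w, C (K u v) w + C (K v w) u + C (K w u) v = 0.
Proof.
move=> lin sym KE u v w.
have Z r x c : C (r *: x) c = r *: C x c.
  by have := lin c r x 0; rewrite addr0 (linear_zero (lin c)) addr0.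
have h a b c : C (K a b) c = k *: (l a *: C b c - l b *: C a c).
  by rewrite KE Z (linear_add (lin c)) (linear_opp (lin c)) !Z.
rewrite !h (sym w v) (sym w u) (sym v u) -!scalerDr.
by rewrite !subrKA subrr scaler0.
Qed.

(** Symmetry of [g (C b v) w] in [v] and [w] makes the two terms of the metric condition equal, so
    [g (C b v) w] is half of [t b v w]. Nondegeneracy then passes to [C] the symmetry of [t] in its
    first two arguments and its vanishing at [y]. *)
Lemma total_symmetry (R : realType) (E : lmodType R) (g : E -> E -> R^o)
    (t : E -> E -> E -> R) (C : E -> E -> E) (y : E) :
  (forall u v, g u v = g v u) -> (forall v, linear (g ^~ v)) ->
  (forall u, (forall v, g u v = 0) -> u = 0) ->
  (forall b u v, t b u v = g (C b u) v + g u (C b v)) ->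
  (forall b v w, g (C b v) w = g (C b w) v) ->
  (forall b v w, t b v w = t v b w) -> (forall v w, t y v w = 0) ->
  (forall b, C b y = 0) /\ (forall b v, C b v = C v b).
Proof.
move=> gsym glin nondeg tE Csym tsym ty.
have gC b v w : g (C b v) w = t b v w / 2.
  have -> : t b v w = g (C b v) w *+ 2 by rewrite tE mulr2n (gsym v) -(Csym b v).
  by rewrite -(mulr_natr (g (C b v) w)) mulfK// pnatr_eq0.
split=> [b|b v].
  by apply: nondeg => w; rewrite gC tsym ty mul0r.
apply/eqP; rewrite -subr_eq0; apply/eqP/nondeg => w.
rewrite (linear_add (glin w)) (linear_opp (glin w)) !gC.
by rewrite (tsym b v w) subrr.
Qed.

(** * Fibre derivatives of a function homogeneous of degree two *)

Section Vertical.
Variables (R : realType) (E : normedModType R).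
Local Notation P := (E * E)%type.
Variables (U : set P) (oU : open U) (L : P -> R^o).
Hypothesis smooth_L : smooth_on U L.
Hypothesis cone : forall p t, U p -> 0 < t ->
  U (p.1, t *: p.2) /\ L (p.1, t *: p.2) = t ^+ 2 * L p.

Definition vmetric (p : P) (u v : E) : R^o :=
  2^-1 * 'D_((0, u) : P) (fun q => 'D_((0, v) : P) L q) p.

Let dil t (p : P) : P := (p.1, t *: p.2).

Let clin_dil t : clin (dil t).
Proof.
split=> [a u v|p].
  by congr pair; rewrite /= scalerDr !scalerA mulrC.
rewrite /dil /continuous_at; apply: cvg_pair; first exact: cvg_fst.
by apply: cvgZ; [exact: cvg_cst|exact: cvg_snd].
Qed.

(** Differentiating the homogeneity relation along the fibre produces a factor [t] on the left; the
    exponent [k.+1] provides the factor that cancels it. *)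
Lemma homogeneous_derive k (f : P -> R^o) w :
  (forall p, U p -> differentiable f p) ->
  (forall p t, U p -> 0 < t -> f (p.1, t *: p.2) = t ^+ k.+1 * f p) ->
  forall p t, U p -> 0 < t ->
    'D_((0, w) : P) f (p.1, t *: p.2) = t ^+ k * 'D_((0, w) : P) f p.
Proof.
move=> df hf p t Up t0.
have [d1 e1] := clin_diff p (clin_dil t).
have Ut : U (dil t p) by case: (cone Up t0).
have := open_eq_derive ((0, w) : P) oU Up (fun q Uq => hf q t Uq t0).
rewrite -[LHS]/('D_((0, w) : P) (f \o dil t) p) (derive_comp _ d1 (df _ Ut)) e1.
have -> : dil t (0, w) = t *: (0, w) + 0 :> P by congr pair; rewrite /= ?addr0 ?scaler0.
rewrite derive_lin ?derive0 ?addr0; last exact: df.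
have -> := @deriveZ _ _ _ f (t ^+ k.+1) p (0, w) (diff_derivable (df _ Up)).
rewrite exprS -scalerA; apply: scalerI; exact: lt0r_neq0.
Qed.

Lemma derive_homogeneous0 (f : P -> R^o) p :
  (forall t, 0 < t -> f (p.1, t *: p.2) = f p) -> 'D_((0, p.2) : P) f p = 0.
Proof.
move=> hf; rewrite (@line_eq_derive _ _ _ f (cst (f p))) ?derive_cst//.
(* The radial line consists of the points [(p.1, (1 + h) *: p.2)]; the bound on [h] keeps the factor
   [1 + h] positive. *)
have : \forall h \near (0 : R), `|h| < 1 by exact: nbhs0_lt.
apply: filterS => h; rewrite ltr_norml => /andP[h1 _].
rewrite /cst -(hf (1 + h)); last by rewrite -ltrBlDl sub0r.
by congr f; congr pair; rewrite /= ?scaler0 ?add0r// scalerDl scale1r addrC.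
Qed.

Let d1L w := smooth_derive ((0, w) : P) smooth_L.
Let d2L v w := smooth_derive ((0, v) : P) (d1L w).

Lemma vmetric_smooth u v : smooth_on U (fun p => vmetric p u v).
Proof.
move=> k; exact: (Ck_scale oU (Ck_cst k U (2^-1 : R^o)) (d2L u v k)).
Qed.

Lemma vmetric_lin1 p v : U p -> linear (fun u => vmetric p u v).
Proof.
move=> Up a x y; rewrite /vmetric.
have -> : (0, a *: x + y) = a *: (0, x) + (0, y) :> P.
  by congr pair; rewrite /= scaler0 addr0.
rewrite derive_lin; last exact: smooth_diff (d1L v) Up.
by rewrite mulrDr; congr (_ + _); rewrite -[RHS]/(_ * (_ * _)) mulrCA.
Qed.

Lemma vmetric_sym p u v : U p -> vmetric p u v = vmetric p v u.
Proof.
by move=> Up; rewrite /vmetric (schwarz _ _ (fbasis_real R) oU Up smooth_L).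
Qed.

Lemma vmetric_lin2 p u : U p -> linear (vmetric p u).
Proof.
by move=> Up a x y; rewrite !(vmetric_sym u)// vmetric_lin1.
Qed.

Let T3 p b v w : R :=
  'D_((0, b) : P) (fun q => 'D_((0, v) : P) (fun q => 'D_((0, w) : P) L q) q) p.

(** Two fibre derivatives of a function of degree 2 have degree 0, hence are constant in the radial
    direction. *)
Let T3_eta p v w : U p -> T3 p p.2 v w = 0.
Proof.
move=> Up; apply: derive_homogeneous0 => t t0.
have h1 := homogeneous_derive (k := 1) w (fun q Uq => smooth_diff smooth_L Uq)
  (fun q s Uq s0 => (cone Uq s0).2).
have := homogeneous_derive (k := 0) v (fun q Uq => smooth_diff (d1L w) Uq) h1 Up t0.
by rewrite expr0 mul1r.
Qed.

Let T3_syml p b v w : U p -> T3 p b v w = T3 p v b w.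
Proof. by move=> Up; exact: (schwarz _ _ (fbasis_real R) oU Up (d1L w)). Qed.

Lemma derive_vmetric p b v w : U p ->
  'D_((0, b) : P) (fun q => vmetric q v w) p = 2^-1 * T3 p b v w.
Proof.
move=> Up; have d := smooth_diff (d2L v w) Up.
exact: (@deriveZ _ _ _ (fun q => 'D_((0, v) : P) (fun q => 'D_((0, w) : P) L q) q)
  2^-1 p (0, b) (diff_derivable d)).
Qed.

Lemma cartan_tensor p (C : E -> E -> E) : U p ->
  (forall b u v, 'D_((0, b) : P) (fun q => vmetric q u v) p =
    vmetric p (C b u) v + vmetric p u (C b v)) ->
  (forall b v w, vmetric p (C b v) w = vmetric p (C b w) v) ->
  (forall u, (forall v, vmetric p u v = 0) -> u = 0) ->
  (forall b, C b p.2 = 0) /\ (forall b v, C b v = C v b).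
Proof.
move=> Up metr sym nondeg.
apply: (@total_symmetry R E (vmetric p)
  (fun b v w => 'D_((0, b) : P) (fun q => vmetric q v w) p)).
- by move=> u v; exact: vmetric_sym.
- by move=> v; exact: vmetric_lin1.
- exact: nondeg.
- exact: metr.
- exact: sym.
- move=> b v w.
  exact: etrans (derive_vmetric b v w Up) (etrans (congr1 (fun r => 2^-1 * r)
    (T3_syml b v w Up)) (esym (derive_vmetric v b w Up))).
- move=> v w.
  exact: etrans (derive_vmetric p.2 v w Up)
    (etrans (congr1 (fun r => 2^-1 * r) (T3_eta v w Up)) (mulr0 _)).
Qed.

End Vertical.

(** * Constant extensions of vectors in a chart *)

Section GoodAtlas.
Variables (R : realType) (E : normedModType R) (X : Type) (A : atlas E X).

(** The set [S] lets one development serve twice: it is the whole space for the base manifold and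
    [TM] for the tangent bundle, whose charts need not be injective on families that are not tangent
    vectors. *)
Record good_atlas (S : set X) : Prop := GoodAtlas {
  good_cover : forall x, S x -> dom (chart_at A x) x;
  good_crdK : forall (i : idx A) x, S x -> dom i x -> pt i (crd i x) = x;
  good_open : forall i j : idx A, open (chart_img i (S `&` dom j));
  good_smooth : forall i j : idx A,
    smooth_on (chart_img i (S `&` dom j)) (transition i j) }.

(** This is [const_ext] with the chart as a parameter instead of the preferred chart of a given
    point. *)
Definition chart_lift (i : idx A) (x : X) (v : E) : tvec A := fun j =>
  if `[< dom i x /\ dom j x >] then 'd (transition i j) (crd i x) v else 0.

Variables (bE : fbasis E) (S : set X) (gA : good_atlas S).

Lemma chart_imgP (i : idx A) (U : set X) e : U `<=` S -> chart_img i U e ->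
  [/\ U (pt i e), dom i (pt i e) & crd i (pt i e) = e].
Proof. by move=> US [x [Ux dx] <-]; rewrite (good_crdK gA) //; exact: US. Qed.

Lemma chart_img_crd (i : idx A) (U : set X) x : U x -> dom i x -> chart_img i U (crd i x).
Proof. by exists x. Qed.

Lemma transition_crd (i j : idx A) x : S x -> dom i x ->
  transition i j (crd i x) = crd j x.
Proof. by move=> Sx dx; rewrite /transition (good_crdK gA). Qed.

Lemma transition_diff (i j : idx A) x : S x -> dom i x -> dom j x ->
  differentiable (transition i j) (crd i x).
Proof.
move=> Sx di dj; apply: (smooth_diff (good_smooth gA i j)).
exact: chart_img_crd.
Qed.

Let overlap_sub (j : idx A) : S `&` dom j `<=` S.
Proof. by move=> x []. Qed.

Lemma cocycle (i j k : idx A) x v : S x -> dom i x -> dom j x -> dom k x ->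
  'd (transition j k) (crd j x) ('d (transition i j) (crd i x) v) =
  'd (transition i k) (crd i x) v.
Proof.
move=> Sx di dj dk.
have dij := transition_diff Sx di dj.
have djk := transition_diff Sx dj dk.
have dik := transition_diff Sx di dk.
have oU := good_open gA i j.
have Ux : chart_img i (S `&` dom j) (crd i x) by exact: chart_img_crd.
have e : forall y, chart_img i (S `&` dom j) y ->
    transition i k y = (transition j k \o transition i j) y.
  move=> y Uy; have [[Sy dj'] di' _] := chart_imgP (@overlap_sub j) Uy.
  by rewrite /= /transition (good_crdK gA).
have d2 : differentiable (transition j k) (transition i j (crd i x)).
  by rewrite transition_crd.
rewrite -[RHS]deriveE// (open_eq_derive v oU Ux e) (derive_comp v dij d2).
by rewrite transition_crd// !deriveE.
Qed.

Lemma transition_id (i : idx A) x v : S x -> dom i x ->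
  'd (transition i i) (crd i x) v = v.
Proof.
move=> Sx di; rewrite -deriveE; last exact: transition_diff.
have Ux : chart_img i (S `&` dom i) (crd i x) by exact: chart_img_crd.
rewrite (open_eq_derive (g := id) v (good_open gA i i) Ux) ?derive_id// => y Uy.
by have [_ _ e] := chart_imgP (@overlap_sub i) Uy.
Qed.

Lemma liftE (i j : idx A) x v : dom i x -> dom j x ->
  chart_lift i x v j = 'd (transition i j) (crd i x) v.
Proof. by move=> di dj; rewrite /chart_lift asboolT. Qed.

Lemma lift_id (i : idx A) x v : S x -> dom i x -> chart_lift i x v i = v.
Proof. by move=> Sx di; rewrite liftE// transition_id. Qed.

Lemma lift_tangent (i : idx A) x v : S x -> dom i x -> tangent x (chart_lift i x v).
Proof.
move=> Sx di; split=> [j k dj dk|j ndj]; first by rewrite !liftE// cocycle.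
by rewrite /chart_lift asboolF// => -[].
Qed.

Lemma tangent_lift (i : idx A) x w : dom i x -> tangent x w -> w = chart_lift i x (w i).
Proof.
move=> di [t1 t2]; apply/funext => j; have [dj|ndj] := pselect (dom j x).
  by rewrite liftE//; exact: t1.
by rewrite t2// /chart_lift asboolF// => -[].
Qed.

(** Identities between tangent vectors are reduced by this to one chart. *)
Lemma tangent_inj (i : idx A) x w w' : dom i x -> tangent x w -> tangent x w' ->
  w i = w' i -> w = w'.
Proof.
by move=> di tw tw' e; rewrite (tangent_lift di tw) (tangent_lift di tw') e.
Qed.

Lemma lift_linear (i : idx A) x a u v :
  chart_lift i x (a *: u + v) = a *: chart_lift i x u + chart_lift i x v.
Proof.
apply/funext => j; rewrite /chart_lift !fctE /chart_lift; case: ifPn => _; first by rewrite linearP.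
by rewrite scaler0 addr0.
Qed.

Lemma tangent_linear x a (u v : tvec A) : tangent x u -> tangent x v ->
  tangent x (a *: u + v : tvec A).
Proof.
move=> [u1 u2] [v1 v2]; split=> [i j di dj|i ni]; rewrite !fctE.
  by rewrite (u1 i j)// (v1 i j)// linearP.
by rewrite u2// v2// scaler0 addr0.
Qed.

Lemma tangent0 x : tangent x (0 : tvec A).
Proof. by split=> // i j di dj; rewrite linear0. Qed.

Definition oset (U : set X) := U `<=` S /\ forall i : idx A, open (chart_img i U).

Section Smooth.
Variables (U : set X) (oU : oset U) (i : idx A) (Ui : U `<=` dom i).

Lemma chart_img_transition (j : idx A) e : chart_img j U e ->
  chart_img j (S `&` dom i) e /\ chart_img i U (transition j i e) /\
  chart_img i (S `&` dom j) (transition j i e) /\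
  pt j e = pt i (transition j i e).
Proof.
case: oU => US _ [x [Ux dj] <-]; have Sx := US _ Ux; have di := Ui Ux.
rewrite transition_crd// !(good_crdK gA)//; split; first exact: chart_img_crd.
by split; [exact: chart_img_crd|split=> //; exact: chart_img_crd].
Qed.

Lemma smooth_transition (j : idx A) : smooth_on (chart_img j U) (transition j i).
Proof.
by apply: smooth_sub (good_smooth gA j i) => e /chart_img_transition[].
Qed.

Lemma smooth_funP (f : X -> R) :
  smooth_on (chart_img i U) (fun e => f (pt i e) : R^o) -> smooth_fun A U f.
Proof.
move=> sf j; have [_ oj] := oU.
apply: (smooth_ext (oj j) (f := fun e => f (pt i (transition j i e)) : R^o)).
  by move=> e /chart_img_transition[_ [_ [_ ->]]].
apply: (smooth_comp (f := fun e => f (pt i e) : R^o) bE (oj j) _ sf (smooth_transition j)).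
by move=> e /chart_img_transition[_ []].
Qed.

(** In another chart [j] the component of [V] is the differential of [transition i j] applied to the
    component in [i], read through [transition j i]; all of these are smooth. *)
Lemma smooth_vfieldP (V : X -> tvec A) : (forall x, U x -> tangent x (V x)) ->
  smooth_on (chart_img i U) (fun e => V (pt i e) i) -> smooth_vfield U V.
Proof.
move=> tV sV; split=> // j; have [US oj] := oU.
pose s e := V (pt i e) i.
apply: (smooth_ext (oj j)
  (f := fun e => 'd (transition i j) (transition j i e) (s (transition j i e)))).
  move=> e Ue; have [_ [_ [_ e1]]] := chart_img_transition Ue.
  have [Up dj _] := chart_imgP US Ue.
  have := (tV _ Up).1 i j (Ui Up) dj.
  by rewrite {2}/transition /s -e1.
apply: (smooth_derive_along (O := chart_img i (S `&` dom j)) bE (oj j)).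
- by move=> e /chart_img_transition[_ [_ []]].
- exact: good_smooth.
- exact: smooth_transition.
- apply: (smooth_comp bE (oj j) _ sV (smooth_transition j)).
  by move=> e /chart_img_transition[_ []].
Qed.

Lemma lift_vfield v : smooth_vfield U (chart_lift i ^~ v).
Proof.
have [US oj] := oU; apply: smooth_vfieldP.
  by move=> x Ux; apply: lift_tangent; [exact: US|exact: Ui].
apply: (smooth_ext (oj i) (f := fun=> v)) => [e Ue|k]; last exact: Ck_cst.
by have [Up di _] := chart_imgP US Ue; rewrite lift_id//; exact: US.
Qed.

Lemma dderivE x v (f : X -> R) : U x -> tangent x v ->
  differentiable (fun e => f (pt i e) : R^o) (crd i x) ->
  dderiv x v f = 'D_(v i) (fun e => f (pt i e) : R^o) (crd i x).
Proof.
move=> Ux tv df; have [US oj] := oU; have Sx := US _ Ux; have di := Ui Ux.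
have dc := good_cover gA Sx; rewrite /dderiv; set c := chart_at A x in dc *.
have Uc : chart_img c U (crd c x) by exact: chart_img_crd.
rewrite (open_eq_derive (g := (fun e => f (pt i e) : R^o) \o transition c i)
  _ (oj c) Uc); last first.
  by move=> e /chart_img_transition[_ [_ [_ ->]]].
have dt := transition_diff Sx dc di.
have e : 'D_(v c) (transition c i) (crd c x) = v i by rewrite deriveE// -(tv.1 c i).
by rewrite (derive_comp _ dt) ?e transition_crd.
Qed.

(** Seen in a chart [j], the two terms of the bracket are the mixed second derivatives of
    [transition i j] in the directions [xi] and [zeta]. *)
Lemma bracket_lift x xi zeta : U x ->
  bracket (chart_lift i ^~ xi) (chart_lift i ^~ zeta) x = 0.
Proof.
move=> Ux; apply/funext => j; rewrite /bracket.
have [dj|ndj] := pselect (dom j x); last by rewrite asboolF.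
rewrite asboolT//; have [US oj] := oU; have Sx := US _ Ux; have di := Ui Ux.
have dji := transition_diff Sx dj di.
have Uj : chart_img j U (crd j x) by exact: chart_img_crd.
have Ui' : chart_img i (S `&` dom j) (crd i x) by exact: chart_img_crd.
have H v w : 'D_(chart_lift i x v j) (fun e => chart_lift i (pt j e) w j) (crd j x) =
    'D_v (fun q => 'D_w (transition i j) q) (crd i x).
  rewrite (open_eq_derive (g := (fun q => 'D_w (transition i j) q) \o transition j i)
    _ (oj j) Uj); last first.
    move=> e Ue; have [Up dj' _] := chart_imgP US Ue.
    rewrite liftE//=; last exact: Ui.
    rewrite /transition deriveE//.
    by apply: transition_diff => //; [exact: US|exact: Ui].
  rewrite (derive_comp _ dji) ?transition_crd//; last first.
    exact: (smooth_diff (smooth_derive w (good_smooth gA i j)) Ui').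
  have -> : 'D_(chart_lift i x v j) (transition j i) (crd j x) = v; last by [].
  by rewrite deriveE// -(lift_tangent v Sx di).1// lift_id.
rewrite !H (schwarz zeta xi bE (good_open gA i j) Ui' (good_smooth gA i j)).
by rewrite subrr.
Qed.

End Smooth.
End GoodAtlas.

(** * The atlas of the tangent bundle *)

Section Manifold.
Variables (R : realType) (n : nat) (M : topologicalType).
Variable A : atlas 'rV[R]_n.+1 M.
Hypothesis hM : smooth_manifold A.

Local Notation E := 'rV[R]_n.+1.
Local Notation P := (E * E)%type.
Local Notation T := (tatlas A).

Let bE : fbasis E := @fbasis_rV R n.+1.
Let bP : fbasis P := fbasis_pair bE bE.

Lemma good_base : good_atlas A setT.
Proof.
split.
- by move=> x _; exact: mfd_cover.
- by move=> i x _; exact: mfd_crdK.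
- move=> i j; rewrite setTI openE => _ [x [dj di] <-].
  have n1 : nbhs (crd i x) (pt i @^-1` dom j).
    apply: (mfd_pt_cont hM di); rewrite (mfd_crdK hM di).
    by apply: open_nbhs_nbhs; split=> //; exact: mfd_dom_open.
  have n2 : nbhs (crd i x) (crd i @` dom i).
    by apply: open_nbhs_nbhs; split; [exact: mfd_img_open|exists x].
  apply: filterS (filterI n1 n2) => e [/= pj [y dy e1]].
  by exists y => //; split=> //; move: pj; rewrite -e1 /= (mfd_crdK hM dy).
- by move=> i j; rewrite setTI; exact: mfd_smooth.
Qed.

Let gA := good_base.

(** The second component is unrestricted because every vector of the model space is the component of
    some lifted tangent vector. *)
Lemma tm_imgP (i j : idx A) (e : P) :
  chart_img (i : idx T) (TM (A := A) `&` dom (j : idx T)) e <->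
  chart_img i (dom j) e.1.
Proof.
split=> [[z [[tz /= dj] /= di] <-]|[x [dj di] e1]]; first by exists z.1.
exists (x, chart_lift i x e.2).
  by split=> //; split=> //; exact: (lift_tangent gA e.2 I di).
rewrite /= (lift_id gA e.2 I di) e1.
by case: e {e1}.
Qed.

Lemma tm_transition (i j : idx A) (e : P) : chart_img i (dom j) e.1 ->
  transition (i : idx T) (j : idx T) e =
  (transition i j e.1, 'd (transition i j : E -> E) (e.1) e.2).
Proof.
move=> [x [dj di] e1].
by rewrite /transition/= -e1 (mfd_crdK hM di) asboolT.
Qed.

Lemma open_base (i j : idx A) : open (chart_img i (dom j)).
Proof. by have := good_open gA i j; rewrite setTI. Qed.

Lemma smooth_base (i j : idx A) : smooth_on (chart_img i (dom j)) (transition i j : E -> E).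
Proof. exact: mfd_smooth. Qed.

Let open_fst (O : set E) : open O -> open [set e : P | O e.1].
Proof. by move=> oO; apply: (open_comp _ oO) => e _; exact: (@clin_fst R E E).2. Qed.

Lemma good_tangent : good_atlas T (TM (A := A)).
Proof.
have eq (i j : idx A) : chart_img (i : idx T) (TM (A := A) `&` dom (j : idx T)) =
    [set e : P | chart_img i (dom j) e.1].
  by apply/seteqP; split=> e /tm_imgP.
have so (i j : idx A) : open (chart_img (i : idx T) (TM (A := A) `&` dom (j : idx T))).
  by rewrite eq; apply: open_fst; exact: (@open_base i j).
have sm (i j : idx A) : smooth_on (chart_img (i : idx T) (TM (A := A) `&` dom (j : idx T)))
    (transition (i : idx T) (j : idx T)).
  rewrite eq; have oW := open_fst (@open_base i j).
  have s1 : smooth_on [set e : P | chart_img i (dom j) e.1] (fst : P -> E).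
    by move=> k; apply: Ck_clin; exact: clin_fst.
  have s2 : smooth_on [set e : P | chart_img i (dom j) e.1] (snd : P -> E).
    by move=> k; apply: Ck_clin; exact: clin_snd.
  have st := smooth_base i j.
  apply: (smooth_ext oW
    (f := fun e : P => (transition i j e.1, 'd (transition i j : E -> E) (e.1) (e.2)))).
    by move=> e We; rewrite tm_transition.
  move=> k; apply: Ck_pair => //.
    exact: (smooth_comp bE oW _ st s1).
  exact: (smooth_derive_along bE oW _ st s1 s2).
split.
- by move=> z _; exact: (mfd_cover hM z.1).
- move=> i [x y] /= ty di; rewrite (mfd_crdK hM di); congr pair.
  apply/funext => j; case: (ty) => t1 t2; have [dj|nj] := pselect (dom j x).
    by rewrite asboolT//; exact: (esym (t1 i j di dj)).
  by rewrite asboolF//; exact: (esym (t2 j nj)).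
- exact: so.
- exact: sm.
Qed.

Let gT := good_tangent.

(** The transition is linear on each fibre, and a vertical line stays in one fibre; so no second
    derivative of the base transition appears. *)
Lemma tm_transition_vert (i j : idx A) (e : P) (b : E) : chart_img i (dom j) e.1 ->
  'D_((0, b) : P) (transition (i : idx T) (j : idx T)) e =
  (0, 'd (transition i j : E -> E) (e.1) b).
Proof.
move=> We; pose f : P -> P := fun q => (0, 'd (transition i j : E -> E) (e.1) q.2).
have dt := smooth_diff (smooth_base i j) We.
have lf : clin f.
  have ld := clin_comp (diff_clin dt) (@clin_snd R E E).
  split=> [a u v|q]; first by rewrite /f /= linearP; congr pair; rewrite /= scaler0 addr0.
  exact: (@Ck_pair R 0 _ _ _ setT _ _ openT (Ck_cst 0 setT (0 : E)) (Ck_clin 0 setT ld) q I).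
have [df e1] := clin_diff e lf.
rewrite (@line_eq_derive _ _ _ _ (cst (transition i j e.1, 0) + f)).
  have d0 : differentiable (cst (transition i j e.1, 0) : P -> P) e.
    exact: differentiable_cst.
  have -> := @deriveD _ _ _ _ _ e (0, b) (diff_derivable d0) (diff_derivable df).
  by rewrite derive_cst add0r e1.
apply: (@filterE _ (nbhs (0 : R))) => h.
have e2 : (h *: ((0, b) : P) + e).1 = e.1 by rewrite /= scaler0 add0r.
rewrite tm_transition e2// !fctE /f.
by congr pair; rewrite /= ?addr0 ?add0r.
Qed.

Lemma tm_transition_fst (i j : idx A) (e xi : P) : chart_img i (dom j) e.1 ->
  ('d (transition (i : idx T) (j : idx T)) e xi).1 =
  'd (transition i j : E -> E) (e.1) xi.1.
Proof.
move=> We.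
have [d1 e1] := clin_diff e (@clin_fst R E E).
have dt := smooth_diff (smooth_base i j) We.
have We' : chart_img (i : idx T) (TM (A := A) `&` dom (j : idx T)) e by exact/tm_imgP.
have dT := smooth_diff (good_smooth gT i j) We'.
have [d2 e2] := clin_diff (transition (i : idx T) (j : idx T) e) (@clin_fst R E E).
rewrite -deriveE// -e2 -(derive_comp _ dT d2).
rewrite (open_eq_derive (g := (transition i j : E -> E) \o fst) _ (good_open gT i j) We').
  by rewrite (derive_comp _ d1 dt) e1 deriveE.
by move=> q /tm_imgP Wq;
  rewrite -[LHS]/((transition (i : idx T) (j : idx T) q).1) (tm_transition Wq).
Qed.

Lemma pi_star_tangent z (X : tvec T) : tangent z X -> tangent z.1 (pi_star X).
Proof.
move=> [t1 t2]; split=> [i j di dj|i ni]; last by rewrite /pi_star t2.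
rewrite /pi_star (t1 i j)// tm_transition_fst//=.
by exists z.1.
Qed.

Lemma pi_star_lift (i : idx A) z xi : TM z -> dom i z.1 ->
  pi_star (chart_lift (i : idx T) z xi) = chart_lift i z.1 xi.1.
Proof.
move=> tz di; apply: (tangent_inj di).
- by apply: pi_star_tangent; exact: (lift_tangent gT).
- exact: (lift_tangent gA).
- by rewrite /pi_star (lift_id gT)// (lift_id gA).
Qed.

(** As for vector fields, except that the fibre of the pullback bundle changes by the differential
    of the base transition at the first component of the point. *)
Lemma smooth_sectionP (U : set (tpoint A)) (i : idx A) (s : tpoint A -> tvec A) :
  openTM U -> (forall z, U z -> dom i z.1) ->
  (forall z, U z -> tangent z.1 (s z)) ->
  smooth_on (chart_img (i : idx T) U) (fun e => s (pt (i : idx T) e) i) ->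
  smooth_section U s.
Proof.
move=> oU Ui ts ss; split=> // j; have [US oj] := oU.
have Ui' : U `<=` dom (i : idx T) by [].
pose g := transition (j : idx T) (i : idx T).
have sg : smooth_on (chart_img (j : idx T) U) g by exact: (smooth_transition gT oU).
apply: (smooth_ext (oj j) (f := fun e : P => 'd (transition i j : E -> E) ((g e).1)
   (s (pt (i : idx T) (g e)) i))).
  move=> e Ue; have [_ [_ [_ e1]]] := chart_img_transition gT oU Ui' Ue.
  have [Up dj _] := chart_imgP gT US Ue.
  have := (ts _ Up).1 i j (Ui _ Up) dj.
  by rewrite /g -e1 /transition /= => ->.
refine (smooth_derive_along (O := chart_img i (dom (j : idx A))) (f := transition i j : E -> E)
  (g := fun e => (g e).1) (h := fun e => s (pt (i : idx T) (g e)) i) bE (oj j) _ _ _ _).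
- move=> e Ue; have [_ [_ [H _]]] := chart_img_transition gT oU Ui' Ue.
  exact/tm_imgP.
- exact: smooth_base.
- by move=> k; exact: (Ck_clin_comp (oj j) (@clin_fst R E E)).
- apply: (smooth_comp (f := fun e => s (pt (i : idx T) e) i) bP (oj j) _ ss sg).
  by move=> e Ue; have [_ []] := chart_img_transition gT oU Ui' Ue.
Qed.

End Manifold.

(** * The Finsler metric in an arbitrary chart *)

Section FinslerChart.
Variables (R : realType) (n : nat) (M : topologicalType).
Variable A : atlas 'rV[R]_n.+1 M.
Hypothesis hM : smooth_manifold A.

Local Notation E := 'rV[R]_n.+1.
Local Notation P := (E * E)%type.
Local Notation T := (tatlas A).

Let gT := good_tangent hM.

Variables (D : set (tpoint A)) (F : tpoint A -> R) (hF : finsler D F).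

Definition chart_dom (i : idx A) : set (tpoint A) := D `&` dom (i : idx T).
Definition chart_set (i : idx A) : set P := chart_img (i : idx T) (chart_dom i).
Definition energy (i : idx A) (e : P) : R^o := F (pt (i : idx T) e) ^+ 2.

Lemma D_tangent z : D z -> TM z.
Proof. by have [h _] := fin_open hF; exact: h. Qed.

Lemma chart_dom_open i : openTM (chart_dom i).
Proof.
have [DT oD] := fin_open hF; split=> [z [/DT//]|j].
have -> : chart_img (j : idx T) (chart_dom i) =
    chart_img (j : idx T) D `&` chart_img (j : idx T) (TM (A := A) `&` dom (i : idx T)).
  apply/seteqP; split=> e.
    move=> [z [[Dz di] dj] <-]; split; first by exists z.
    by exists z => //; split=> //; split=> //; exact: DT.
  move=> [e1 e2]; have [Dz dj ez] := chart_imgP gT DT e1.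
  exists (pt j e) => //; split=> //; split=> //.
  have sT : TM (A := A) `&` dom (i : idx T) `<=` TM (A := A) by move=> ? [].
  by have [[]] := chart_imgP gT sT e2.
by apply: openI; [exact: oD|exact: good_open].
Qed.

Lemma chart_set_open i : open (chart_set i).
Proof. exact: (chart_dom_open i).2. Qed.

Lemma chart_dom_sub i : chart_dom i `<=` TM (A := A).
Proof. exact: (chart_dom_open i).1. Qed.

Lemma chart_setP i e : chart_set i e ->
  chart_dom i (pt (i : idx T) e) /\ crd (i : idx T) (pt (i : idx T) e) = e.
Proof. by move=> Oe; have [] := chart_imgP gT (@chart_dom_sub i) Oe. Qed.

Lemma chart_setI i z : D z -> dom i z.1 -> chart_set i (crd (i : idx T) z).
Proof. by move=> Dz di; exists z. Qed.

Lemma crdK_D i z : D z -> dom i z.1 -> pt (i : idx T) (crd (i : idx T) z) = z.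
Proof. by move=> Dz di; apply: (good_crdK gT) => //; exact: D_tangent. Qed.

Lemma energy_smooth i : smooth_on (chart_set i) (energy i).
Proof.
have sF : smooth_on (chart_set i) (fun e => F (pt (i : idx T) e) : R^o).
  apply: smooth_sub (fin_smooth hF i) => e [z [[Dz _] di] <-]; by exists z.
by move=> k; exact: (Ck_scale (@chart_set_open i) (sF k) (sF k)).
Qed.

Lemma energy_cone i p t : chart_set i p -> 0 < t ->
  chart_set i (p.1, t *: p.2) /\ energy i (p.1, t *: p.2) = t ^+ 2 * energy i p.
Proof.
move=> [[x y] [[Dz dx] _] <-] t0.
have Dt := fin_conic hF t0 Dz.
split; first by exists (x, t *: y).
have Et w : D (x, w) -> energy i (crd i x, w i) = F (x, w) ^+ 2.
  by move=> Dw; rewrite /energy -[(crd i x, w i)]/(crd (i : idx T) (x, w)) crdK_D.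
by rewrite (Et _ Dt) (Et _ Dz) (fin_homog hF t0 Dz) exprMn.
Qed.

(** The definition of [fmetric] uses the preferred chart of [z]. Chart changes are linear on fibres,
    so two vertical derivatives of the energy transform as a bilinear form, without second
    derivatives of the transition. *)
Lemma fmetricE i z u v : D z -> dom i z.1 -> tangent z.1 u -> tangent z.1 v ->
  fmetric F z u v = vmetric (energy i) (crd (i : idx T) z) (u i) (v i).
Proof.
move=> Dz di tu tv; have dc := mfd_cover hM z.1.
set c := chart_at A z.1 in dc.
have Tz := D_tangent Dz.
rewrite -[LHS]/(vmetric (energy c) (crd (c : idx T) z) (u c) (v c)) /vmetric.
apply: (congr1 (fun r : R => 2^-1 * r)).
set q0 : P := crd (c : idx T) z.
pose tau := transition (c : idx T) (i : idx T).
pose O := chart_img (c : idx T) (chart_dom i).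
have oO : open O by exact: (chart_dom_open i).2.
have Oq0 : O q0 by exists z.
have OP q : O q -> chart_img c (dom i) q.1.
  by move=> [w [[Dw dw] dcw] <-]; exists w.1.
have si : chart_dom i `<=` dom (i : idx T) by move=> ? [].
have Ot q : O q -> chart_set i (tau q) /\ energy c q = energy i (tau q).
  move=> Oq; have [_ [h1 [_ h2]]] := chart_img_transition gT (@chart_dom_open i) si Oq.
  by split=> //; rewrite /energy h2.
have sE := energy_smooth i.
have dtau q : O q -> differentiable tau q.
  move=> Oq; apply: (smooth_diff (good_smooth gT c i)).
  exact/(tm_imgP hM)/OP.
have taux : tau q0 = crd (i : idx T) z by exact: (transition_crd gT (i : idx T) Tz dc).
have d1 (b : E) q : O q -> 'D_((0, b) : P) (energy c) q =
    'D_((0, 'd (transition c i : E -> E) (q.1) b) : P) (energy i) (tau q).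
  move=> Oq; have [cs _] := Ot q Oq.
  have e1 := open_eq_derive ((0, b) : P) oO Oq (g := energy i \o tau) (fun y Oy => (Ot y Oy).2).
  have e2 := derive_comp ((0, b) : P) (dtau _ Oq) (smooth_diff sE cs).
  have e3 := tm_transition_vert hM b (OP _ Oq).
  apply: (etrans e1); apply: (etrans e2).
  exact: (congr1 (fun d : P => 'D_d (energy i) (tau q)) e3).
have tui : 'd (transition c i : E -> E) (q0.1) (u c) = u i.
  by rewrite (tu.1 c i).
have tvi : 'd (transition c i : E -> E) (q0.1) (v c) = v i.
  by rewrite (tv.1 c i).
have [cs _] := Ot _ Oq0.
have e1 := open_eq_derive ((0, u c) : P) oO Oq0 (d1 (v c)).
(* The inner direction depends on [q.1] only, which is constant along the vertical line; it keeps
   the value [v i]. *)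
have e2 : 'D_((0, u c) : P) (fun q => 'D_((0, 'd (transition c i : E -> E) (q.1) (v c)) : P)
    (energy i) (tau q)) q0 =
    'D_((0, u c) : P) ((fun q => 'D_((0, v i) : P) (energy i) q) \o tau) q0.
  apply: line_eq_derive; apply: (@filterE _ (nbhs (0 : R))) => h.
  have e0 : (h *: ((0, u c) : P) + q0).1 = q0.1 by rewrite /= scaler0 add0r.
  by rewrite e0 tvi.
have e3 := derive_comp ((0, u c) : P) (dtau _ Oq0)
  (smooth_diff (smooth_derive ((0, v i) : P) sE) cs).
have e4 := tm_transition_vert hM (u c) (OP _ Oq0).
apply: (etrans e1); apply: (etrans e2); apply: (etrans e3).
have e5 : 'D_((0, u c) : P) tau q0 = (0, u i) by apply: (etrans e4); rewrite tui.
exact: (congr2 (fun d q : P => 'D_d (fun q => 'D_((0, v i) : P) (energy i) q) q) e5 taux).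
Qed.

End FinslerChart.

(** * Connections in a chart *)

Section ConnectionChart.
Variables (R : realType) (n : nat) (M : topologicalType).
Variable A : atlas 'rV[R]_n.+1 M.
Hypothesis hM : smooth_manifold A.

Local Notation E := 'rV[R]_n.+1.
Local Notation P := (E * E)%type.
Local Notation T := (tatlas A).

Let bE : fbasis E := @fbasis_rV R n.+1.
Let bP : fbasis P := fbasis_pair bE bE.
Let gA := good_base hM.
Let gT := good_tangent hM.

Variables (D : set (tpoint A)) (F : tpoint A -> R) (hF : finsler D F).
Variables (nabla : connection A) (hL : linear_connection D nabla).

Section Chart.
Variable i : idx A.
Local Notation iT := (i : idx T).
Local Notation Ui := (chart_dom D i).
Local Notation Oi := (chart_set D i).

Definition csec (w : E) : tpoint A -> tvec A := fun z => chart_lift i z.1 w.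
Definition cfield (xi : P) : tpoint A -> tvec T := fun z => chart_lift iT z xi.

Let oU : openTM Ui := chart_dom_open hM hF i.
Let oO : open Oi := @chart_set_open _ _ _ _ hM _ _ hF i.
Let UD : Ui `<=` D. Proof. by move=> ? []. Qed.
Let Ud : Ui `<=` dom iT. Proof. by move=> ? []. Qed.
Let UT : Ui `<=` TM (A := A). Proof. exact: oU.1. Qed.

Lemma aroundU z (Q : set (tpoint A) -> Prop) : Ui z -> Q Ui -> around D z Q.
Proof. by move=> Uz QU; exists Ui. Qed.

Lemma smooth_sectionU s : (forall z, Ui z -> tangent z.1 (s z)) ->
  smooth_on Oi (fun e => s (pt iT e) i) -> smooth_section Ui s.
Proof. by move=> ts ss; apply: (smooth_sectionP hM (i := i) oU). Qed.

Lemma csec_tangent w z : Ui z -> tangent z.1 (csec w z).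
Proof. by move=> [_ di]; exact: (lift_tangent gA). Qed.

Lemma cfield_tangent xi z : Ui z -> tangent z (cfield xi z).
Proof. by move=> Uz; apply: (lift_tangent gT); [exact: UT|exact: Ud]. Qed.

Lemma csec_i w z : Ui z -> csec w z i = w.
Proof. by move=> [_ di]; exact: (lift_id gA). Qed.

Lemma cfield_i xi z : Ui z -> cfield xi z i = xi.
Proof. by move=> Uz; apply: (lift_id gT); [exact: UT|exact: Ud]. Qed.

Lemma csec_smooth w : smooth_section Ui (csec w).
Proof.
apply: smooth_sectionU; first by move=> z; exact: csec_tangent.
apply: (smooth_ext oO (f := fun=> w)) => [e /(chart_setP hM hF)[Ue _]|k]; last exact: Ck_cst.
by rewrite csec_i.
Qed.

Lemma cfield_smooth xi : smooth_vfield Ui (cfield xi).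
Proof. exact: (lift_vfield bP gT oU Ud). Qed.

Lemma smooth_section_comp s : smooth_section Ui s ->
  smooth_on Oi (fun e => s (pt iT e) i).
Proof. by move=> [_ ss]; exact: ss. Qed.

Lemma section_add s1 s2 : smooth_section Ui s1 -> smooth_section Ui s2 ->
  smooth_section Ui (fun z => s1 z + s2 z).
Proof.
move=> h1 h2; apply: smooth_sectionU => [z Uz|k].
  by have := tangent_linear 1 (h1.1 z Uz) (h2.1 z Uz); rewrite scale1r.
by have := Ck_add oO (h1.2 i k) (h2.2 i k).
Qed.

Lemma section_scale (f : tpoint A -> R) s :
  smooth_on Oi (fun e => f (pt iT e) : R^o) -> smooth_section Ui s ->
  smooth_section Ui (fun z => f z *: s z).
Proof.
move=> hf hs; apply: smooth_sectionU => [z Uz|k].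
  have := tangent_linear (f z) (hs.1 z Uz) (@tangent0 _ _ _ A z.1).
  by rewrite addr0.
by have := Ck_scale oO (hf k) (hs.2 i k).
Qed.

Lemma section0 : smooth_section Ui (fun=> 0).
Proof. by apply: smooth_sectionU => [z _|k]; [exact: tangent0|exact: Ck_cst]. Qed.

Lemma nabla_tangent z X s : Ui z -> tangent z X -> smooth_section Ui s ->
  tangent z.1 (nabla z X s).
Proof.
move=> Uz tX hs; rewrite (tangent_lift (Ud Uz) tX).
by have [h _] := conn_smooth hL oU UD (cfield_smooth (X i)) hs; exact: h.
Qed.

Definition Gam (p xi : P) (w : E) : E := nabla (pt iT p) (cfield xi (pt iT p)) (csec w) i.

Lemma nabla_linear z s (a : R) X Y : Ui z -> smooth_section Ui s -> tangent z X ->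
  tangent z Y -> nabla z (a *: X + Y) s = a *: nabla z X s + nabla z Y s.
Proof. by move=> Uz hs; apply: (conn_linear hL); [exact: UD|exact: aroundU]. Qed.

Lemma nabla0l z s : Ui z -> smooth_section Ui s -> nabla z 0 s = 0.
Proof.
move=> Uz hs; have t0 := @tangent0 _ _ _ T z.
have := nabla_linear 1 Uz hs t0 t0; rewrite !scale1r addr0.
by move/eqP; rewrite -subr_eq0 opprD addrA subrr sub0r oppr_eq0 => /eqP.
Qed.

Lemma nabla_add z X s1 s2 : Ui z -> tangent z X -> smooth_section Ui s1 ->
  smooth_section Ui s2 ->
  nabla z X (fun z' => s1 z' + s2 z') = nabla z X s1 + nabla z X s2.
Proof.
by move=> Uz tX h1 h2; apply: (conn_add hL) => //;
  [exact: UD|exact: aroundU|exact: aroundU].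
Qed.

Lemma nabla_local z X s1 s2 : Ui z -> tangent z X -> smooth_section Ui s1 ->
  (forall z', Ui z' -> s1 z' = s2 z') -> nabla z X s1 = nabla z X s2.
Proof.
move=> Uz tX h1 e; apply: (conn_local hL) => //; [exact: UD|exact: aroundU|].
exact: (aroundU (Q := fun U => forall z', U z' -> s1 z' = s2 z')).
Qed.

Lemma nabla_leibniz z X (f : tpoint A -> R) s : Ui z -> tangent z X ->
  smooth_on Oi (fun e => f (pt iT e) : R^o) -> smooth_section Ui s ->
  nabla z X (fun z' => f z' *: s z') =
  'D_(X i) (fun e => f (pt iT e) : R^o) (crd iT z) *: s z + f z *: nabla z X s.
Proof.
move=> Uz tX hf hs.
rewrite -(dderivE gT oU Ud Uz tX); last first.
  by apply: (smooth_diff hf); exact: (chart_setI Uz.1 Uz.2).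
have sf : smooth_fun T Ui f by exact: (smooth_funP bP gT oU Ud hf).
have a1 : around D z (fun U => smooth_fun T U f) by exists Ui.
have a2 : around D z (fun U => smooth_section U s) by exists Ui.
exact: (conn_leibniz hL (UD Uz) a1 a2 tX).
Qed.

Lemma nabla0 z X : Ui z -> tangent z X -> nabla z X (fun=> 0) = 0.
Proof.
move=> Uz tX; have h := nabla_add Uz tX section0 section0.
have e : (fun z' : tpoint A => (0 : tvec A) + 0) = fun=> 0.
  by apply/funext => z'; rewrite addr0.
rewrite e in h.
by move/eqP: h; rewrite -subr_eq0 opprD addrA subrr sub0r oppr_eq0 => /eqP.
Qed.

Lemma nabla_sum z X (I : Type) (r : seq I) (f : I -> tpoint A -> R) (b : I -> E) :
  Ui z -> tangent z X ->
  (forall k, smooth_on Oi (fun e => f k (pt iT e) : R^o)) ->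
  smooth_section Ui (fun z' => \sum_(k <- r) f k z' *: csec (b k) z') /\
  nabla z X (fun z' => \sum_(k <- r) f k z' *: csec (b k) z') =
  \sum_(k <- r) ('D_(X i) (fun e => f k (pt iT e) : R^o) (crd iT z) *: csec (b k) z +
    f k z *: nabla z X (csec (b k))).
Proof.
move=> Uz tX hf; elim: r => [|k r [IH1 IH2]].
  have -> : (fun z' => \sum_(k <- [::]) f k z' *: csec (b k) z') = fun=> 0.
    by apply/funext => z'; rewrite big_nil.
  by rewrite big_nil; split; [exact: section0|exact: nabla0].
have -> : (fun z' => \sum_(k <- k :: r) f k z' *: csec (b k) z') =
    (fun z' => f k z' *: csec (b k) z' + \sum_(k <- r) f k z' *: csec (b k) z').
  by apply/funext => z'; rewrite big_cons.
have hk := section_scale (hf k) (csec_smooth (b k)).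
split; first exact: section_add.
by rewrite big_cons (nabla_add Uz tX hk IH1) IH2 (nabla_leibniz Uz tX (hf k) (csec_smooth (b k))).
Qed.

Lemma Gam_lin1 p w : Oi p -> linear (fun xi => Gam p xi w).
Proof.
move=> /(chart_setP hM hF)[Up _] a x y; rewrite /Gam /cfield lift_linear.
have h := nabla_linear a Up (csec_smooth w) (cfield_tangent x Up) (cfield_tangent y Up).
exact: (congr1 (fun v : tvec A => v i) h).
Qed.

Lemma Gam_lin2 p xi : Oi p -> linear (Gam p xi).
Proof.
move=> /(chart_setP hM hF)[Up _] a x y; rewrite /Gam.
have tX := cfield_tangent xi Up.
have hx := csec_smooth x; have hy := csec_smooth y.
have ha : smooth_on Oi (fun e => (fun=> a : R) (pt iT e) : R^o) by move=> k; exact: Ck_cst.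
have h1 := section_scale ha hx.
have e : csec (a *: x + y) = (fun z => (fun=> a) z *: csec x z + csec y z).
  by apply/funext => z; rewrite /csec lift_linear.
rewrite e (nabla_add Up tX h1 hy) (nabla_leibniz Up tX ha hx).
rewrite -[X in X *: csec x _]/('D_(cfield xi (pt iT p) i) (cst (a : R^o)) _).
by rewrite derive_cst scale0r add0r.
Qed.

Lemma Gam_smooth xi w : smooth_on Oi (fun p => Gam p xi w).
Proof.
have h := conn_smooth hL oU UD (cfield_smooth xi) (csec_smooth w).
exact: (smooth_section_comp h).
Qed.

Lemma GamE z xi w : Ui z -> Gam (crd iT z) xi w = nabla z (cfield xi z) (csec w) i.
Proof. by move=> Uz; rewrite /Gam (crdK_D hM hF Uz.1 Uz.2). Qed.

(** Locality replaces [s] by its expansion in constant sections with smooth coefficients. The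
    Leibniz rule then differentiates the coefficients, and what remains is [Gam] by linearity. *)
Lemma covE z X s : Ui z -> tangent z X -> smooth_section Ui s ->
  nabla z X s i = 'D_(X i) (fun e => s (pt iT e) i) (crd iT z)
    + Gam (crd iT z) (X i) (s z i).
Proof.
move=> Uz tX hs; have [I [b [c [lc bc]]]] := bE.
pose f k (z : tpoint A) : R := c k (s z i).
have hf k : smooth_on Oi (fun e => f k (pt iT e) : R^o).
  by move=> m; exact: (Ck_clin_comp oO (lc k) (hs.2 i m)).
have es z' : Ui z' -> s z' = \sum_k f k z' *: csec (b k) z'.
  move=> Uz'; rewrite [LHS](@tangent_lift _ _ _ A i z'.1 _ Uz'.2 (hs.1 _ Uz')).
  rewrite [X in chart_lift i z'.1 X](bc (s z' i)).
  by rewrite (linear_lincomb (f := chart_lift i z'.1)) // => a u v; rewrite lift_linear.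
rewrite (nabla_local Uz tX hs es).
have [_ ->] := nabla_sum (index_enum I) b Uz tX hf.
rewrite fct_sumE.
have Oz := chart_setI Uz.1 Uz.2.
have ds : differentiable (fun e => s (pt iT e) i) (crd iT z).
  exact: (smooth_diff (hs.2 i) Oz).
rewrite [X in _ = X + _](bc _) [X in _ = _ + Gam _ _ X](bc _).
rewrite (linear_lincomb _ _ (Gam_lin2 _ Oz)) -big_split/=; apply: eq_bigr => k _.
rewrite !fctE csec_i//; congr (_ *: _ + _ *: _).
  have [d1 d2] := clin_diff (s (pt iT (crd iT z)) i) (lc k).
  rewrite -d2 -(derive_comp (X i) ds d1).
  by [].
by rewrite GamE// /cfield -(tangent_lift (Ud Uz) tX).
Qed.

End Chart.
End ConnectionChart.

(** * The Cartan connection *)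

(* Otherwise unification unfolds iterated derivatives when it compares two
   values of the metric. *)
Opaque vmetric.

Section Cartan.
Variables (R : realType) (n : nat) (M : topologicalType).
Variable A : atlas 'rV[R]_n.+1 M.
Hypothesis hM : smooth_manifold A.

Local Notation E := 'rV[R]_n.+1.
Local Notation P := (E * E)%type.
Local Notation T := (tatlas A).

Let gT := good_tangent hM.

Variables (D : set (tpoint A)) (F : tpoint A -> R) (hF : finsler D F).
Variables (nabla : connection A) (hC : cartan_connection nabla D F).
Let hL := cartan_linear hC.

Let DT z : D z -> TM z := @D_tangent _ _ _ _ _ _ hF z.

Lemma vertical_horizontal z X : D z -> vertical z X -> Kmap nabla z X = 0 -> X = 0.
Proof.
move=> Dz vX kX; have [_ h] := cartan_regular hC Dz.
have HX : (vertical (A := A) z `&` horizontal nabla z) X.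
  by split=> //; split=> //; case: vX.
by rewrite h in HX.
Qed.

Section Chart.
Variable i : idx A.
Local Notation iT := (i : idx T).
Local Notation Ui := (chart_dom D i).
Local Notation Oi := (chart_set D i).
Local Notation G := (Gam nabla i).
Local Notation m := (vmetric (energy F i)).
Local Notation hor := (hor G).

Let oU : openTM Ui := chart_dom_open hM hF i.
Let oO : open Oi := @chart_set_open _ _ _ _ hM _ _ hF i.
Let UD : Ui `<=` D. Proof. by move=> ? []. Qed.
Let Ud : Ui `<=` dom iT. Proof. by move=> ? []. Qed.

Lemma eta_smooth : smooth_section Ui (@eta R n M A).
Proof.
apply: (smooth_sectionU hM hF); first by move=> z [/DT].
apply: (smooth_ext oO (f := snd)) => [e|k]; last exact/Ck_clin/clin_snd.
by move=> /(chart_setP hM hF)[_ {1}<-].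
Qed.

(** In the chart the section [eta] is the second coordinate, whose derivative along [X] is the
    vertical component of [X]. *)
Lemma Kmap_chart z X : Ui z -> tangent z X ->
  Kmap nabla z X i = (X i).2 + G (crd iT z) (X i) (z.2 i).
Proof.
move=> Uz tX; rewrite /Kmap (covE hM hF hL Uz tX eta_smooth); congr (_ + _).
have Oz := chart_setI Uz.1 Uz.2.
have [d e] := clin_diff (crd iT z) (@clin_snd R E E).
rewrite -(e (X i)); apply: (open_eq_derive _ oO Oz) => q.
by move=> /(chart_setP hM hF)[_ {2}<-].
Qed.

Lemma Kmap_tangent z X : Ui z -> tangent z X -> tangent z.1 (Kmap nabla z X).
Proof. by move=> Uz tX; exact: (nabla_tangent hM hF hL Uz tX eta_smooth). Qed.

Lemma metr_chart p xi u v : Oi p ->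
  'D_xi (fun q => m q u v) p = m p (G p xi u) v + m p u (G p xi v).
Proof.
move=> Op; have [Uz ez] := chart_setP hM hF Op.
set z := pt iT p in Uz ez.
have tX : tangent z (cfield i xi z) by exact: (cfield_tangent hM hF).
have hu : smooth_section Ui (csec i u) := csec_smooth hM hF i u.
have hv : smooth_section Ui (csec i v) := csec_smooth hM hF i v.
have a1 : around D z (fun U => smooth_section U (csec i u)) by exists Ui.
have a2 : around D z (fun U => smooth_section U (csec i v)) by exists Ui.
have tn w : tangent z.1 (nabla z (cfield i xi z) (csec i w)).
  exact: (nabla_tangent hM hF hL Uz tX (csec_smooth hM hF i w)).
have h := cartan_metrical hC Uz.1 a1 a2 tX.
have fE e : Oi e ->
    m e u v = fmetric F (pt iT e) (csec i u (pt iT e)) (csec i v (pt iT e)).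
  move=> Oe; have [Ue ee] := chart_setP hM hF Oe.
  have t w := csec_tangent hM w Ue.
  have := fmetricE hM hF Ue.1 Ue.2 (t u) (t v).
  by rewrite (csec_i hM u Ue) (csec_i hM v Ue) ee => ->.
have dm : differentiable (fun q => m q u v) p.
  exact: (smooth_diff (vmetric_smooth oO (energy_smooth hM hF i) u v)).
have df := open_eq_differentiable oO Op fE dm.
have e1 := dderivE gT oU Ud Uz tX (f := fun z' => fmetric F z' (csec i u z') (csec i v z')).
rewrite ez in e1; have {}e1 := e1 df.
have tc w := csec_tangent hM w Uz.
have eG w : G p xi w = nabla z (cfield i xi z) (csec i w) i by [].
rewrite !eG.
have e2 : fmetric F z (nabla z (cfield i xi z) (csec i u)) (csec i v z) =
    m p (nabla z (cfield i xi z) (csec i u) i) v.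
  have H := fmetricE hM hF Uz.1 Uz.2 (tn u) (tc v).
  apply: (etrans H).
  by rewrite (csec_i hM v Uz) ez; exact: erefl.
have e3 : fmetric F z (csec i u z) (nabla z (cfield i xi z) (csec i v)) =
    m p u (nabla z (cfield i xi z) (csec i v) i).
  have H := fmetricE hM hF Uz.1 Uz.2 (tc u) (tn v).
  apply: (etrans H).
  by rewrite (csec_i hM u Uz) ez; exact: erefl.
rewrite e2 e3 in h.
have e4 := open_eq_derive xi oO Op fE.
apply: (etrans e4); apply: (etrans _ h); apply: (etrans _ (esym e1)).
by rewrite (cfield_i hM hF xi Uz); exact: erefl.
Qed.

Lemma nondeg_chart z : Ui z -> forall u, (forall v, m (crd iT z) u v = 0) -> u = 0.
Proof.
move=> Uz u hu; have t w := csec_tangent hM w Uz.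
have /(congr1 (fun w : tvec A => w i)) : csec i u z = 0.
  apply: (fin_nondeg hF Uz.1 (t u)) => v tv.
  have := fmetricE hM hF Uz.1 Uz.2 (t u) tv.
  by rewrite (csec_i hM u Uz) hu.
by rewrite (csec_i hM u Uz).
Qed.

End Chart.
End Cartan.

(** * Horizontal and vertical lifts, and the (h)hv-torsion *)

Section Cartan.
Variables (R : realType) (n : nat) (M : topologicalType).
Variable A : atlas 'rV[R]_n.+1 M.
Hypothesis hM : smooth_manifold A.

Local Notation E := 'rV[R]_n.+1.
Local Notation P := (E * E)%type.
Local Notation T := (tatlas A).

Let bE : fbasis E := @fbasis_rV R n.+1.
Let bP : fbasis P := fbasis_pair bE bE.
Let gT := good_tangent hM.

Variables (D : set (tpoint A)) (F : tpoint A -> R) (hF : finsler D F).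
Variables (nabla : connection A) (hC : cartan_connection nabla D F).
Let hL := cartan_linear hC.

Let DT z : D z -> TM z := @D_tangent _ _ _ _ _ _ hF z.

Lemma chart_dom_at z : D z -> chart_dom D (chart_at A z.1) z.
Proof. by move=> Dz; split=> //; exact: (mfd_cover hM z.1). Qed.

Lemma lift0 (i : idx A) x : chart_lift i x 0 = 0.
Proof. by apply/funext => j; rewrite /chart_lift; case: ifP => // _; rewrite linear0. Qed.

Lemma Kmap_linear z (a : R) X Y : D z -> tangent z X -> tangent z Y ->
  Kmap nabla z (a *: X + Y) = a *: Kmap nabla z X + Kmap nabla z Y.
Proof.
move=> Dz tX tY.
exact: (nabla_linear hM hF hL a (chart_dom_at Dz) (eta_smooth hM hF _) tX tY).
Qed.

Lemma Kmap_sub z X Y : D z -> tangent z X -> tangent z Y ->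
  Kmap nabla z (X - Y) = Kmap nabla z X - Kmap nabla z Y.
Proof.
move=> Dz tX tY; rewrite -scaleN1r addrC Kmap_linear//.
by rewrite scaleN1r addrC.
Qed.

Lemma tangent_sub z (X Y : tvec T) : tangent z X -> tangent z Y ->
  tangent z (X - Y : tvec T).
Proof.
by move=> tX tY; rewrite -scaleN1r addrC; exact: tangent_linear.
Qed.

Lemma vlift_Kmap z X : D z -> vertical z X -> vlift nabla z (Kmap nabla z X) = X.
Proof.
move=> Dz vX; apply: xget_unique => // Y [vY kY].
apply/eqP; rewrite -subr_eq0; apply/eqP.
apply: (vertical_horizontal hC Dz).
  split; first exact: (tangent_sub vY.1 vX.1).
  apply/funext => j; have [_ /(congr1 (fun f : tvec A => f j)) e1] := vY.
  have [_ /(congr1 (fun f : tvec A => f j)) e2] := vX.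
  by rewrite /pi_star !fctE -[LHS]/((Y j).1 - (X j).1) [(Y j).1]e1 [(X j).1]e2 subrr.
by rewrite (Kmap_sub Dz vY.1 vX.1) kY subrr.
Qed.

Lemma horizontal_inj z X Y : D z -> horizontal nabla z X -> horizontal nabla z Y ->
  pi_star X = pi_star Y -> X = Y.
Proof.
move=> Dz [tX kX] [tY kY] e; apply/eqP; rewrite -subr_eq0; apply/eqP.
apply: (vertical_horizontal hC Dz); last by rewrite (Kmap_sub Dz tX tY) kX kY subrr.
split; first exact: tangent_sub.
apply/funext => j; have /(congr1 (fun f : tvec A => f j)) e1 := e.
by rewrite /pi_star !fctE -[LHS]/((X j).1 - (Y j).1) [(X j).1]e1 subrr.
Qed.

Lemma hliftP z u : D z -> tangent z.1 u ->
  horizontal nabla z (hlift nabla z u) /\ pi_star (hlift nabla z u) = u.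
Proof.
move=> Dz tu.
suff /(xgetPex 0) h : exists X, [set X | horizontal nabla z X /\ pi_star X = u] X.
  exact: h.
pose i := chart_at A z.1; have di : dom i z.1 := mfd_cover hM z.1.
(* Any vector over [u] would do: regularity splits it, and its horizontal part still projects to [u]
   because the vertical part projects to zero. *)
pose X := cfield i (u i, 0) z.
have tX : tangent z X by exact: (cfield_tangent hM hF _ (chart_dom_at Dz)).
have [reg _] := cartan_regular hC Dz; have [V [H [vV hH XE]]] := reg X tX.
exists H; split=> //; apply: (tangent_inj di) => //; first exact: (pi_star_tangent hM hH.1).
have V1 : (V i).1 = 0 by have /(congr1 (fun f : tvec A => f i)) := vV.2.
have XiE : X i = V i + H i by rewrite XE.
have XiV : X i = (u i, 0) by exact: (cfield_i hM hF _ (chart_dom_at Dz)).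
by have := congr1 fst (etrans (esym XiV) XiE); rewrite /= V1 add0r => ->.
Qed.

Lemma hlift_unique z X : D z -> horizontal nabla z X -> hlift nabla z (pi_star X) = X.
Proof.
move=> Dz hX; have tX := pi_star_tangent hM hX.1.
have [h e] := hliftP Dz tX; exact: (horizontal_inj Dz h hX e).
Qed.

(** With its first argument written as [K X], the vertical lift returns [X], whatever [K] is. The
    constant extension of [X] stays vertical and commutes with that of the horizontal lift of [v],
    so one of the three terms of the torsion survives. *)
Lemma hv_torsionE z (i := chart_at A z.1) b v : D z -> tangent z.1 v ->
  hv_torsion nabla z (Kmap nabla z (cfield i (0, b) z)) v =
  nabla z (cfield i (0, b) z) (csec i (v i)).
Proof.
move=> Dz tv; have Uz := chart_dom_at Dz; rewrite -/i in Uz.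
have oU : openTM (chart_dom D i) := chart_dom_open hM hF i.
set X := cfield i (0, b) z.
have tX : tangent z X by exact: (cfield_tangent hM hF).
have vX : vertical z X.
  split=> //; rewrite /X /cfield (pi_star_lift hM _ (DT Dz) Uz.2); exact: lift0.
rewrite /hv_torsion (vlift_Kmap Dz vX).
have [hY eY] := hliftP Dz tv; set Y := hlift nabla z v in hY eY *.
have XE : const_ext z X = cfield i (0, b).
  by rewrite -[LHS]/(cfield i (X i)) /X (cfield_i hM hF _ Uz).
have Yi : (Y i).1 = v i by rewrite -eY.
have YE : const_ext z Y = cfield i (Y i) by [].
rewrite /torsion XE YE.
have pX z' : chart_dom D i z' -> pi_star (cfield i (0, b) z') = 0.
  by move=> Uz'; rewrite /cfield (pi_star_lift hM _ (DT Uz'.1) Uz'.2) lift0.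
have pY z' : chart_dom D i z' -> csec i (v i) z' = pi_star (cfield i (Y i) z').
  by move=> Uz'; rewrite /cfield (pi_star_lift hM _ (DT Uz'.1) Uz'.2) Yi.
have tYz : tangent z (cfield i (Y i) z) by exact: (cfield_tangent hM hF).
rewrite -(nabla_local hM hF hL Uz tX (csec_smooth hM hF i (v i)) pY).
rewrite -(nabla_local hM hF hL Uz tYz (section0 hM hF i) (fun z' Uz' => esym (pX z' Uz'))).
rewrite (nabla0 hM hF hL Uz tYz) subr0.
have dT : chart_dom D i `<=` dom (i : idx T) by move=> ? [].
have := bracket_lift bP gT oU dT (0, b) (Y i) Uz => br.
have -> : bracket (cfield i (0, b)) (cfield i (Y i)) z = 0 by exact: br.
have -> : pi_star (0 : tvec T) = 0 :> tvec A by [].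
by rewrite subr0.
Qed.

Lemma hv_torsion_tangent z (i := chart_at A z.1) b v : D z -> tangent z.1 v ->
  tangent z.1 (hv_torsion nabla z (Kmap nabla z (cfield i (0, b) z)) v).
Proof.
by move=> Dz tv; rewrite (hv_torsionE b Dz tv); exact: (nabla_tangent hM hF hL (chart_dom_at Dz)
  (cfield_tangent hM hF _ (chart_dom_at Dz)) (csec_smooth hM hF _ _)).
Qed.

Lemma hv_torsion_chart z (i := chart_at A z.1) b v : D z -> tangent z.1 v ->
  hv_torsion nabla z (Kmap nabla z (cfield i (0, b) z)) v i =
  Gam nabla i (crd (i : idx T) z) (0, b) (v i).
Proof.
by move=> Dz tv; rewrite (hv_torsionE b Dz tv) (GamE hM hF nabla _ _ (chart_dom_at Dz)).
Qed.

(** The chart is the preferred one at [z], because the (h)hv-torsion is evaluated on extensions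
    constant in that chart; there [hv_torsion_chart] turns the symmetry of the torsion into that of
    the vertical part of [Gam]. *)
Lemma cartan_chart z (i := chart_at A z.1) (G := Gam nabla i (crd (i : idx T) z)) : D z ->
  (forall b, G (0, b) (z.2 i) = 0) /\ (forall b v, G (0, b) v = G (0, v) b).
Proof.
move=> Dz; have Uz := chart_dom_at Dz; rewrite -/i in Uz.
have Oz := chart_setI Uz.1 Uz.2.
have oO : open (chart_set D i) := @chart_set_open _ _ _ _ hM _ _ hF i.
apply: (cartan_tensor oO (energy_smooth hM hF i) (fun p t => @energy_cone _ _ _ _ hM _ _ hF i p t)
  (p := crd (i : idx T) z) (C := fun b v => G (0, b) v) Oz).
- by move=> b u v; exact: (metr_chart hM hF hC (0, b) u v Oz).
- move=> b v w.
  have t x := csec_tangent hM x Uz.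
  have tK := Kmap_tangent hM hF hC Uz (cfield_tangent hM hF (0, b) Uz).
  have h := cartan_hv_torsion hC Dz tK (t v) (t w).
  have tT x : tangent z.1 (hv_torsion nabla z (Kmap nabla z (cfield i (0, b) z)) (csec i x z)).
    exact: hv_torsion_tangent.
  have e x y : vmetric (energy F i) (crd (i : idx T) z) (G (0, b) x) y =
      fmetric F z (hv_torsion nabla z (Kmap nabla z (cfield i (0, b) z)) (csec i x z))
        (csec i y z).
    apply: esym; apply: etrans (fmetricE hM hF Uz.1 Uz.2 (tT x) (t y)) _.
    have := hv_torsion_chart b Dz (t x); rewrite -/i (csec_i hM x Uz) => ->.
    by rewrite (csec_i hM y Uz); exact: erefl.
  apply: (etrans (e v w)).
  apply: (etrans h).
  apply: esym.
  exact: (e w v).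
- exact: (nondeg_chart hM hF Uz).
Qed.

End Cartan.

(** * Horizontal fields, and the h-curvature in a chart *)

Section Cartan.
Variables (R : realType) (n : nat) (M : topologicalType).
Variable A : atlas 'rV[R]_n.+1 M.
Hypothesis hM : smooth_manifold A.

Local Notation E := 'rV[R]_n.+1.
Local Notation P := (E * E)%type.
Local Notation T := (tatlas A).

Let bE : fbasis E := @fbasis_rV R n.+1.
Let bP : fbasis P := fbasis_pair bE bE.
Let gT := good_tangent hM.

Variables (D : set (tpoint A)) (F : tpoint A -> R) (hF : finsler D F).
Variables (nabla : connection A) (hC : cartan_connection nabla D F).
Let hL := cartan_linear hC.

Let DT z : D z -> TM z := @D_tangent _ _ _ _ _ _ hF z.

(** [cartan_chart] speaks of the preferred chart of [z], which varies with [z], while the Bianchi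
    identity needs [vert] at all points of one fixed chart. On a vertical vector, [K] and the
    vertical component change by the same base differential, which carries their equality to every
    chart. *)
Lemma Kmap_vert z X (j : idx A) : D z -> vertical z X -> dom j z.1 ->
  Kmap nabla z X j = (X j).2.
Proof.
move=> Dz vX dj; have Uz := chart_dom_at hM Dz.
set i := chart_at A z.1 in Uz; have di : dom i z.1 := Uz.2.
have Xi : X i = (0, (X i).2).
  have := congr1 (fun f : tvec A => f i) vX.2; rewrite /pi_star.
  by case: (X i) => a b /= ->.
have Ki : Kmap nabla z X i = (X i).2.
  rewrite (Kmap_chart hM hF hC Uz vX.1) {2}Xi.
  by have [-> _] := cartan_chart hM hF hC Dz; rewrite addr0.
have Wz : chart_img i (dom j) (crd (i : idx T) z).1 by exists z.1.
rewrite ((Kmap_tangent hM hF hC Uz vX.1).1 i j di dj) Ki.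
have dT : differentiable (transition (i : idx T) (j : idx T)) (crd (i : idx T) z).
  exact: (transition_diff gT (DT Dz)).
have e := tm_transition_vert hM (X i).2 Wz.
rewrite (deriveE _ dT) -Xi in e.
by rewrite (vX.1.1 (i : idx T) (j : idx T) di dj) e.
Qed.

Section Chart.
Variable i : idx A.
Local Notation iT := (i : idx T).
Local Notation Ui := (chart_dom D i).
Local Notation Oi := (chart_set D i).
Local Notation G := (Gam nabla i).
Local Notation hor := (hor G).

Let oU : openTM Ui := chart_dom_open hM hF i.
Let oO : open Oi := @chart_set_open _ _ _ _ hM _ _ hF i.
Let UD : Ui `<=` D. Proof. by move=> ? []. Qed.
Let Ud : Ui `<=` dom iT. Proof. by move=> ? []. Qed.

Lemma cfield_vertical b z : Ui z -> vertical z (cfield i (0, b) z).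
Proof.
move=> Uz; split; first exact: (cfield_tangent hM hF).
by rewrite /cfield (pi_star_lift hM _ (DT Uz.1) Uz.2) lift0.
Qed.

Lemma vert_chart p b : Oi p -> G p (0, b) p.2 = 0.
Proof.
move=> Op; have [Uz ez] := chart_setP hM hF Op.
have vX := cfield_vertical b Uz; have := Kmap_vert Uz.1 vX Uz.2.
rewrite (Kmap_chart hM hF hC Uz vX.1) (cfield_i hM hF _ Uz) ez.
have -> : (pt iT p).2 i = p.2 by rewrite -[in RHS]ez.
by move/eqP; rewrite -subr_eq0 addrAC subrr add0r => /eqP.
Qed.

(** The torsion condition asks for fields that are horizontal on a whole open set, which constant
    fields in general are not. *)
Definition hfield (u : E) (z : tpoint A) : tvec T := cfield i (hor (crd iT z) u) z.

Lemma hfield_smooth u : smooth_vfield Ui (hfield u).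
Proof.
apply: (smooth_vfieldP bP gT oU Ud) => [z Uz|]; first exact: (cfield_tangent hM hF).
(* Smoothness of the nonlinear coefficients comes from the smoothness of [nabla] applied to [eta]
   along the constant field [(u, 0)]: its vertical component is zero, so [K] of it is exactly this
   coefficient. *)
have sN : smooth_on Oi (fun e => G e (u, 0) e.2).
  have h := conn_smooth hL oU UD (cfield_smooth hM hF i (u, 0)) (eta_smooth hM hF i).
  apply: (smooth_ext oO _ (smooth_section_comp h)) => e Oe.
  have [Ue ee] := chart_setP hM hF Oe.
  have := Kmap_chart hM hF hC Ue (cfield_tangent hM hF (u, 0) Ue).
  rewrite (cfield_i hM hF _ Ue) ee add0r.
  by have -> : (pt iT e).2 i = e.2 by rewrite -[in RHS]ee.
apply: (smooth_ext oO (f := fun e => hor e u)) => [e Oe|k].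
  have [Ue ee] := chart_setP hM hF Oe.
  by rewrite /hfield (cfield_i hM hF _ Ue) ee.
apply: (Ck_pair oO (Ck_cst k Oi u)).
apply: (Ck_ext oO _ (Ck_scale oO (Ck_cst k Oi (-1 : R^o)) (sN k))) => e _.
by rewrite scaleN1r.
Qed.

Lemma horE p u : Oi p -> G p (hor p u) p.2 = G p (u, 0) p.2.
Proof.
move=> Op; rewrite /hor.
have -> : (u, - G p (u, 0) p.2) = (u, 0) + (0, - G p (u, 0) p.2) :> P.
  by congr pair; rewrite /= ?addr0 ?add0r.
by rewrite (linear_add (Gam_lin1 hM hF hL p.2 Op)) (vert_chart _ Op) addr0.
Qed.

Lemma hfield_horizontal u z : Ui z -> horizontal nabla z (hfield u z).
Proof.
move=> Uz; have Oz := chart_setI Uz.1 Uz.2.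
have tX : tangent z (hfield u z) by exact: (cfield_tangent hM hF).
split=> //; apply: (@tangent_inj _ _ _ A i z.1 _ _ Uz.2).
- exact: (Kmap_tangent hM hF hC Uz tX).
- exact: tangent0.
rewrite (Kmap_chart hM hF hC Uz tX) /hfield (cfield_i hM hF _ Uz) (horE u Oz).
by rewrite addNr.
Qed.

Lemma pi_star_hfield u z : Ui z -> pi_star (hfield u z) = csec i u z.
Proof. by move=> Uz; rewrite /hfield /cfield (pi_star_lift hM _ (DT Uz.1) Uz.2). Qed.

Lemma derive_fst_cst (f : P -> P) (p v : P) (u : E) : Oi p ->
  (forall q, Oi q -> (f q).1 = u) -> differentiable f p -> ('D_v f p).1 = 0.
Proof.
move=> Op fu df; have [d e] := clin_diff (f p) (@clin_fst R E E).
rewrite -e -(derive_comp _ df d).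
by rewrite (open_eq_derive (g := cst u) _ oO Op) ?derive_cst.
Qed.

(** Both fields have constant base components, so their bracket is vertical and drops out of the
    torsion after projection. *)
Lemma bracket_hfield_fst u v z : Ui z -> (bracket (hfield u) (hfield v) z i).1 = 0.
Proof.
move=> Uz; have Oz := chart_setI Uz.1 Uz.2.
have fu w q : Oi q -> (hfield w (pt iT q) i).1 = w.
  by move=> Oq; have [Uq _] := chart_setP hM hF Oq; rewrite /hfield (cfield_i hM hF _ Uq).
have df w : differentiable (fun e => hfield w (pt iT e) i) (crd iT z).
  exact: (smooth_diff ((hfield_smooth w).2 i) Oz).
rewrite /bracket asboolT; last exact: Uz.2.
have e1 := derive_fst_cst (hfield u z i) Oz (fu v) (df v).
have e2 := derive_fst_cst (hfield v z i) Oz (fu u) (df u).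
exact: (etrans (congr2 (fun a b : E => a - b) e1 e2) (subrr 0)).
Qed.

Lemma tors_chart p u v : Oi p -> G p (hor p u) v = G p (hor p v) u.
Proof.
move=> Op; have [Uz ez] := chart_setP hM hF Op; set z := pt iT p in Uz ez.
have hh w w' z' : Ui z' -> horizontal nabla z' (hfield w z') /\ horizontal nabla z' (hfield w' z').
  by move=> Uz'; split; exact: hfield_horizontal.
have H := congr1 (fun f : tvec A => f i)
  (cartan_h_torsion hC oU UD (hfield_smooth u) (hfield_smooth v) (hh u v) Uz).
have tX w : tangent z (hfield w z) := (hfield_horizontal w Uz).1.
have nE w w' : nabla z (hfield w z) (fun z' => pi_star (hfield w' z')) =
    nabla z (hfield w z) (csec i w').
  apply: esym; apply: (nabla_local hM hF hL Uz (tX w) (csec_smooth hM hF i w')).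
  by move=> z' Uz'; rewrite pi_star_hfield.
rewrite /torsion !nE in H.
have {}H : nabla z (hfield u z) (csec i v) i - nabla z (hfield v z) (csec i u) i -
  (bracket (hfield u) (hfield v) z iT).1 = 0 by exact: H.
rewrite (bracket_hfield_fst u v Uz) subr0 in H.
have {}H := subr0_eq H.
have hE w : hfield w z = cfield i (hor p w) z by rewrite /hfield ez.
rewrite !hE in H; exact: H.
Qed.

Lemma hlift_chart z u : Ui z -> tangent z.1 u ->
  hlift nabla z u = cfield i (hor (crd iT z) (u i)) z.
Proof.
move=> Uz tu; have hX := hfield_horizontal (u i) Uz.
rewrite -[RHS]/(hfield (u i) z) -(hlift_unique hM hF hC Uz.1 hX) pi_star_hfield//.
by rewrite /csec -(@tangent_lift _ _ _ A i z.1 u Uz.2 tu).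
Qed.

End Chart.

(** The definition extends the two horizontal lifts by constants in the preferred chart. These
    extensions commute, and [covE] expands the outer derivative of each iterated covariant
    derivative, the inner one being [Gam] itself. *)
Lemma h_curvature_chart z (i := chart_at A z.1) u v w : D z ->
  tangent z.1 u -> tangent z.1 v -> tangent z.1 w ->
  tangent z.1 (h_curvature nabla z u v w) /\
  h_curvature nabla z u v w i =
  curv (Gam nabla i) (crd (i : idx T) z) (hor (Gam nabla i) (crd (i : idx T) z) (u i))
    (hor (Gam nabla i) (crd (i : idx T) z) (v i)) (w i).
Proof.
move=> Dz tu tv tw; have Uz := chart_dom_at hM Dz; rewrite -/i in Uz.
have oU : openTM (chart_dom D i) := chart_dom_open hM hF i.
have oO : open (chart_set D i) := @chart_set_open _ _ _ _ hM _ _ hF i.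
have UD : chart_dom D i `<=` D by move=> ? [].
have Ud : chart_dom D i `<=` dom (i : idx T) by move=> ? [].
have Oz := chart_setI Uz.1 Uz.2.
rewrite /h_curvature (hlift_chart Uz tu) (hlift_chart Uz tv).
set xi := hor _ _ (u i); set zeta := hor _ _ (v i).
have XE x : const_ext z (cfield i x z) = cfield i x.
  by rewrite -[LHS]/(cfield i (cfield i x z i)) (cfield_i hM hF _ Uz).
have sE : sec_ext z w = csec i (w i) by [].
rewrite /curvature !XE sE.
have br : bracket (cfield i xi) (cfield i zeta) z = 0 by exact: (bracket_lift bP gT oU Ud).
rewrite br (nabla0l hM hF hL Uz (csec_smooth hM hF i (w i))) subr0.
have t x : tangent z (cfield i x z) := cfield_tangent hM hF x Uz.
have s x : smooth_section (chart_dom D i) (fun z' => nabla z' (cfield i x z') (csec i (w i))).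
  exact: (conn_smooth hL oU UD (cfield_smooth hM hF i x) (csec_smooth hM hF i (w i))).
have tt x y := nabla_tangent hM hF hL Uz (t x) (s y).
split.
  by rewrite -scaleN1r addrC; exact: tangent_linear.
rewrite -[LHS]/(nabla z _ _ i - nabla z _ _ i).
rewrite (covE hM hF hL Uz (t xi) (s zeta)) (covE hM hF hL Uz (t zeta) (s xi)).
rewrite !(cfield_i hM hF _ Uz) -!(GamE hM hF nabla _ _ Uz) opprD addrACA.
exact: erefl.
Qed.

End Cartan.

(** * Comparison of nullity and kernel at a point *)

Section Nullity.
Variables (R : realType) (n : nat) (M : topologicalType).
Variable A : atlas 'rV[R]_n.+1 M.
Hypothesis hM : smooth_manifold A.

Local Notation E := 'rV[R]_n.+1.
Local Notation P := (E * E)%type.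
Local Notation T := (tatlas A).

Let bE : fbasis E := @fbasis_rV R n.+1.

Variables (D : set (tpoint A)) (F : tpoint A -> R) (hF : finsler D F).
Variables (nabla : connection A) (hC : cartan_connection nabla D F).
Let hL := cartan_linear hC.

Variables (z : tpoint A) (Dz : D z).
Let i := chart_at A z.1.
Let p : P := crd (i : idx T) z.
Let Uz : chart_dom D i z := chart_dom_at hM Dz.
Let Oz : chart_set D i p := chart_setI Uz.1 Uz.2.
Let oO : open (chart_set D i) := @chart_set_open _ _ _ _ hM _ _ hF i.
Let G := Gam nabla i.
Let Rc u v w : E := curv G p (hor G p u) (hor G p v) w.
Let g : E -> E -> R^o := vmetric (energy F i) p.
Let C b v := G p (0, b) v.
Let ts u : tangent z.1 (csec i u z) := csec_tangent hM u Uz.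

Let C_lin w : linear (C ^~ w).
Proof.
move=> a x y; have h := Gam_lin1 hM hF hL w Oz a (0, x) (0, y).
have e : (0, a *: x + y) = a *: (0, x) + (0, y) :> P.
  by congr pair; rewrite /= scaler0 addr0.
by rewrite /C e; exact: h.
Qed.

Let C_sym b v : C b v = C v b.
Proof. by have [_ h] := cartan_chart hM hF hC Dz; exact: h. Qed.

Let Rc_bianchi u v w : Rc u v w + Rc v w u + Rc w u v =
  C (Rc u v p.2) w + C (Rc v w p.2) u + C (Rc w u p.2) v.
Proof.
exact: (bianchi bE oO (fun q Oq w => Gam_lin1 hM hF hL w Oq)
  (fun q Oq xi => Gam_lin2 hM hF hL xi Oq) (Gam_smooth hM hF hL i)
  (fun q Oq b => vert_chart hM hF hC b Oq) (fun q Oq u v => tors_chart hM hF hC u v Oq)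
  u v w Oz).
Qed.

Let Rc_skew u v w t : g (Rc u v w) t = - g w (Rc u v t).
Proof.
have sE := energy_smooth hM hF i.
exact: (curv_skew bE oO (Gam_smooth hM hF hL i)
  (fun q Oq v => vmetric_lin1 sE v Oq) (fun q Oq u => vmetric_lin2 oO sE u Oq)
  (vmetric_smooth oO sE) (fun q Oq xi u v => metr_chart hM hF hC xi u v Oq) _ _ _ _ Oz).
Qed.

Let g_sym u v : g u v = g v u.
Proof. exact: (vmetric_sym oO (energy_smooth hM hF i) u v Oz). Qed.

Let g_lin v : linear (g ^~ v).
Proof. exact: (vmetric_lin1 (energy_smooth hM hF i) v Oz). Qed.

Let g_nondeg u : (forall v, g u v = 0) -> u = 0.
Proof. exact: (nondeg_chart hM hF Uz). Qed.

Let Rc_anti u v w : Rc u v w = - Rc v u w.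
Proof. by rewrite /Rc /curv opprD !opprB. Qed.

Let curvature0 u v w : tangent z.1 u -> tangent z.1 v -> tangent z.1 w ->
  h_curvature nabla z u v w = 0 <-> Rc (u i) (v i) (w i) = 0.
Proof.
move=> tu tv tw; have [t e] := h_curvature_chart hM hF hC Dz tu tv tw.
split=> [h|h]; first by rewrite /Rc -e h.
by apply: (@tangent_inj _ _ _ A i z.1 _ _ Uz.2 t (@tangent0 _ _ _ A z.1)); rewrite e.
Qed.

Lemma nullity_kernel : (forall u v w, Rc u v w + Rc v w u + Rc w u v = 0) ->
  nullity nabla z = kernelR nabla z.
Proof.
move=> cyc.
have pair u v w t : g (Rc u v w) t = g (Rc w t u) v.
  exact: (riemann_pair_symmetry Rc_anti g_lin g_sym Rc_skew cyc).
have g0 u : g 0 u = 0 by exact: (linear_zero (g_lin u)).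
have ci u : csec i u z i = u by exact: (csec_i hM u Uz).
apply/seteqP; split=> [u [X [hX nX] <-]|w [tw kw]].
  have tX := pi_star_tangent hM hX.1.
  split=> // Y Z hY hZ; apply/curvature0 => //; try exact: (pi_star_tangent hM).
    exact: (pi_star_tangent hM hY.1).
    exact: (pi_star_tangent hM hZ.1).
  (* The exchange puts the nullity vector in the first slot. The test vector [t] then has to be the
     projection of a horizontal vector, which [hliftP] provides. *)
  apply: g_nondeg => t; rewrite pair.
  have [hT eT] := hliftP hM hF hC Dz (ts t).
  have := nX _ hT _ (ts (pi_star Y i)).
  by rewrite eT => /(curvature0 tX (ts t) (ts _)); rewrite !ci => ->.
have [hX eX] := hliftP hM hF hC Dz tw; exists (hlift nabla z w) => //.
split=> // Y hY w' tw'; rewrite eX.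
have tY := pi_star_tangent hM hY.1.
(* Here the exchange puts [w] in the third slot, the one that the kernel condition tests. *)
apply/(curvature0 tw tY tw'); apply: g_nondeg => t; rewrite pair.
have [hW eW] := hliftP hM hF hC Dz tw'; have [hT eT] := hliftP hM hF hC Dz (ts t).
have := kw _ _ hW hT; rewrite eW eT => /(curvature0 tw' (ts t) tw).
by rewrite ci => ->.
Qed.

Let Rc_hat u v : Rc u v p.2 = h_curvature_hat nabla z (csec i u z) (csec i v z) i.
Proof.
have tz : tangent z.1 (eta z) by exact: (D_tangent hF Dz).
have [_ e] := h_curvature_chart hM hF hC Dz (ts u) (ts v) tz.
apply: esym; apply: (etrans e).
by rewrite (csec_i hM u Uz) (csec_i hM v Uz); exact: erefl.
Qed.

Lemma cyclic_flat :
  (forall u v, tangent z.1 u -> tangent z.1 v -> h_curvature_hat nabla z u v = 0) ->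
  forall u v w, Rc u v w + Rc v w u + Rc w u v = 0.
Proof.
move=> flat u v w; rewrite Rc_bianchi.
have h a b : Rc a b p.2 = 0 by rewrite Rc_hat flat.
by rewrite !h !(linear_zero (C_lin _)) !addr0.
Qed.

Lemma cyclic_isotropic (k : R) (l : tvec A -> R) :
  (forall u v, tangent z.1 u -> tangent z.1 v ->
     h_curvature_hat nabla z u v = k *: (l u *: v - l v *: u)) ->
  forall u v w, Rc u v w + Rc v w u + Rc w u v = 0.
Proof.
move=> iso u v w; rewrite Rc_bianchi.
(* The form on tangent vectors is read on chart components through constant sections. *)
pose l' a := l (csec i a z).
apply: (isotropic_cyclic (K := fun a b => Rc a b p.2) (k := k) (l := l') C_lin C_sym) => a b.
rewrite Rc_hat iso// -[LHS]/(k *: (l' a *: csec i b z i - l' b *: csec i a z i)).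
by rewrite (csec_i hM a Uz) (csec_i hM b Uz).
Qed.

End Nullity.

Theorem corollary2p6 (R : realType) (n : nat) (M : topologicalType)
  (A : atlas 'rV[R]_n.+1 M) (D : set (tpoint A)) (F : tpoint A -> R)
  (nabla : connection A)
  (hM : smooth_manifold A) (hF : finsler D F)
  (hC : cartan_connection nabla D F)
  (hR :
    (forall z, D z -> forall u v, tangent z.1 u -> tangent z.1 v ->
       h_curvature_hat nabla z u v = 0)
    \/
    (exists lam : tpoint A -> R, homogeneous0 D lam /\
       forall z, D z -> forall u v, tangent z.1 u -> tangent z.1 v ->
         h_curvature_hat nabla z u v =
           (lam z * F z) *: (ell F z u *: v - ell F z v *: u))) :
  forall z, D z -> nullity nabla z = kernelR nabla z.
Proof.
move=> z Dz; apply: (nullity_kernel hM hF hC Dz).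
case: hR => [flat|[lam [_ iso]]].
  exact: (cyclic_flat hM hF hC Dz (flat z Dz)).
exact: (cyclic_isotropic hM hF hC Dz (iso z Dz)).
Qed.
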